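(* Let $k>2$ and let $sc_k=(k,k-1,\ldots,1)$. For every $S\in SYT(sc_k)$, $\iota(\epsilon(S))=\epsilon(\iota(S))$, where $\iota: SYT(sc_k)\to SYT(k^{(k+1)})$ is the embedding defined in the context and $\epsilon$ denotes evacuation (on $SYT(sc_k)$ on the left-hand side and on $SYT(k^{(k+1)})$ on the right-hand side).
   Context: Tableaux are in English notation; box $(i,j)$ is in row $i$ from the top and column $j$ from the left, and $T[i,j]$ is the entry of $T$ in that box. $SYT(\lambda)$ is the set of standard Young tableaux of shape $\lambda$. $c^r$ is the rectangular partition $(c,\ldots,c)$ with $r$ parts, so $k^{(k+1)}$ has $k+1$ rows and $k$ columns. Sliding: given a standard filling of a (skew) shape, remove the largest entry, leaving its box empty. Repeatedly move into the empty box the larger of the entries directly north and directly west of it (or the only one present), so the empty box moves to the position of that entry, until no box of the shape lies directly north or west of the empty box. Evacuation: for $T\in SYT(\lambda)$ with $|\lambda|=m$, put $T_0=T$, $\lambda_0=\lambda$. For $k=0,1,\ldots,m-1$: apply sliding to $T_k$ (a filling of the skew shape $\lambda_k$) and let $(i_k,j_k)$ be the final position of the empty box. Set $\epsilon(T)[i_k,j_k]=k+1$. Delete box $(i_k,j_k)$ to obtain $\lambda_{k+1}$ and $T_{k+1}$. This defines $\epsilon(T)\in SYT(\lambda)$. Embedding $\iota$: for $S\in SYT(sc_k)$ let $N=k(k+1)$. The tableau $R=\iota(S)\in SYT(k^{(k+1)})$ is given, for $1\le i\le k+1$, $1\le j\le k$, by $R[i,j]=S[i,j]$ if $i+j\le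 k+1$, and $R[i,j]=N+1-\epsilon(S)[k+2-i,\,k+1-j]$ if $i+j>k+1$. *)

(* Defs.v *)
From HB Require Import structures.
From mathcomp Require Import all_boot.
From mathcomp Require Import finmap.

Set Implicit Arguments.
Unset Strict Implicit.
Unset Printing Implicit Defensive.

Local Open Scope fset_scope.
Local Open Scope fmap_scope.

(* Boxes are 1-indexed: [(i, j)] is in row [i] from the top and column [j]
   from the left, so no shape contains a box with a coordinate equal to 0. *)
Definition box := (nat * nat)%type.

Definition north (b : box) : box := (b.1.-1, b.2).
Definition west (b : box) : box := (b.1, b.2.-1).

Definition diagram (la : seq nat) : {fset box} :=
  seq_fset tt [seq (i.+1, j.+1) | i <- iota 0 (size la), j <- iota 0 (nth 0 la i)].

(* A filling of a finite set of boxes; the (possibly skew) shape is [domf T]. *)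
Definition filling := {fmap box -> nat}.

(* The value 0 off the shape is a dummy. *)
Definition entry (T : filling) (b : box) : nat := odflt 0 T.[? b].

Definition is_SYT (la : seq nat) (T : filling) : Prop :=
  [/\ domf T = diagram la,
      perm_eq [seq entry T b | b <- domf T] (iota 1 (sumn la)),
      forall i j, (i, j) \in domf T -> (i, j.+1) \in domf T ->
        entry T (i, j) < entry T (i, j.+1)
    & forall i j, (i, j) \in domf T -> (i.+1, j) \in domf T ->
        entry T (i, j) < entry T (i.+1, j)].

Definition largest_box (T : filling) : option box :=
  omap val [pick b : domf T | [forall c : domf T, T c <= T b]].

(* The box whose entry moves into the empty box [b]. *)
Definition next_box (T : filling) (b : box) : option box :=
  match T.[? north b], T.[? west b] with
  | Some x, Some y => Some (if y < x then north b else west b)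
  | Some _, None => Some (north b)
  | None, Some _ => Some (west b)
  | None, None => None
  end.

(* The empty box [b] is kept out of [domf T].  Each move lowers the sum of the
   coordinates of the empty box, so [n := b.1 + b.2] moves always suffice. *)
Fixpoint slide_from (n : nat) (T : filling) (b : box) : filling * box :=
  if n is n'.+1 then
    if next_box T b is Some c then
      slide_from n' (T.[b <- entry T c].[~ c]) c
    else (T, b)
  else (T, b).

(* The resulting filling, with the final empty box deleted from its shape, and
   that final empty box. The empty filling has no box; (0, 0) is a dummy. *)
Definition sliding (T : filling) : filling * box :=
  if largest_box T is Some b then slide_from (b.1 + b.2) T.[~ b] b
  else (T, (0, 0)).

Fixpoint evac_from (n k : nat) (T : filling) : filling :=
  if n is n'.+1 then
    let: (T', b) := sliding T in (evac_from n' k.+1 T').[b <- k.+1]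
  else [fmap].

Definition evac (T : filling) : filling := evac_from #|` domf T| 0 T.

Definition staircase (k : nat) : seq nat := rev (iota 1 k).

Definition rectangle (k : nat) : seq nat := nseq k.+1 k.

Definition embed (k : nat) (S : filling) : filling :=
  let N := k * k.+1 in
  [fmap b : diagram (rectangle k) =>
    let: (i, j) := val b in
    if i + j <= k.+1 then entry S (i, j)
    else N.+1 - entry (evac S) (k.+2 - i, k.+1 - j)].

(* Main.v *)
Require Import Defs.
From mathcomp Require Import all_boot ssralg ssrnum ssrint.
From mathcomp Require Import finmap zify.

Set Implicit Arguments.
Unset Strict Implicit.
Unset Printing Implicit Defensive.

(** Write a standard tableau as the list of its boxes in the order of their
    entries.  Its prefixes are the order ideals of a saturated chain in Young's
    lattice, and sliding becomes a run of toggles: the box of the largest entry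
    travels towards the front; it changes places with a predecessor that is
    neither north nor west of it, and otherwise stays and lets that predecessor
    travel on.  Evacuation iterates this run on shorter and shorter tails.

    Two facts give the theorem.  First, evacuation is an involution.  This holds
    for lists under any symmetric rule that says which neighbours may not be
    exchanged: evacuating [x :: s] amounts to evacuating [s] and then undoing a
    slide from [x] ([evacuate_cons]), and slides are reversible ([evacuateK]).
    Second, on a rectangle evacuation is the half turn combined with the
    reversal of the entries ([evacuate_rectangle]).

    Granting these, let [s] be the list of [S].  The list of the embedded tableau
    is [s] followed by the half turn of [evacuate s] read backwards.  Turning it
    by the second fact gives [evacuate s] followed by the half turn of [s] read
    backwards, and by the first fact this is the embedding of [evacuate s].

    The second fact is proved with Haiman's elementary dual equivalences, which
    exchange two of three consecutive boxes when the diagonal of the third lies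
    strictly between theirs.  A slide that starts later in the list carries a
    dual equivalence to the dual equivalence one place further
    ([slide_act_dual]); this reduces to an identity on four boxes that only
    mentions their diagonals ([toggles_dual]).  At the end of a rectangle the
    corner forces what remains, so that on rectangles evacuation carries the
    dual equivalence at place i to the one at the mirror place
    ([evacuate_act_dual]).  The half turn does the same, since it reverses the
    order of the diagonals ([rotate_act_dual]).
    Dual equivalences act transitively on the tableaux of a given shape
    ([dual_connected]), hence it is enough that evacuation and the half turn
    agree on one tableau.  Both carry the descent set to its mirror image, and
    the tableau filled row after row is the only one of rectangular shape that
    has descents only at the ends of rows; both fix it. *)

(** * Evacuation of a list of boxes *)
Definition content (b : box) : int := (b.2%:Z - b.1%:Z)%R.

(** In a list whose prefixes are order ideals, two consecutive boxes lie on
    neighbouring diagonals exactly when the first is north or west of the second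
    ([chain_adjacent]).  Stating the rule by diagonals makes it symmetric and
    leaves only integers to compare. *)
Definition neighbour_diagonals (x y : box) : bool :=
  (content x == content y + 1)%R || (content y == content x + 1)%R.

Definition toggle (s : seq box) : seq box :=
  if s is x :: y :: s' then
    if neighbour_diagonals x y then s else y :: x :: s'
  else s.

(** The last box is the empty one; it travels to the front. When the toggle
    leaves two boxes in place, the empty box has moved into the earlier one and
    the entry of the latter has taken its place. *)
Fixpoint slide (s : seq box) : seq box :=
  if s is x :: s' then toggle (x :: slide s') else [::].

Fixpoint evacuate_rec (n : nat) (s : seq box) : seq box :=
  if n is n'.+1 then
    if slide s is b :: s' then b :: evacuate_rec n' s' else [::]
  else [::].

Definition evacuate (s : seq box) : seq box := evacuate_rec (size s) s.

(** The front box travels to the end by the toggles of [slide] in reverse. *)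
Fixpoint sift (x : box) (s : seq box) : seq box :=
  if s is y :: s' then
    if neighbour_diagonals x y then x :: sift y s' else y :: sift x s'
  else [:: x].

Definition unslide (s : seq box) : seq box :=
  if s is x :: s' then sift x s' else [::].

Lemma neighbour_diagonalsC x y :
  neighbour_diagonals x y = neighbour_diagonals y x.
Proof. by rewrite /neighbour_diagonals orbC. Qed.

Lemma unslide_cons x y s : unslide [:: x, y & s] =
  if neighbour_diagonals x y then x :: unslide (y :: s)
  else y :: unslide (x :: s).
Proof. by []. Qed.

Lemma perm_toggle s : perm_eq (toggle s) s.
Proof.
case: s => [|x [|y s]] //=; case: ifP => // _.
by rewrite -[y :: x :: s]/([:: y] ++ [:: x] ++ s) perm_catCA.
Qed.

Lemma perm_slide s : perm_eq (slide s) s.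
Proof.
elim: s => // x s IHs; apply: (perm_trans (perm_toggle (x :: slide s))).
by rewrite perm_cons.
Qed.

Lemma size_slide s : size (slide s) = size s.
Proof. exact/perm_size/perm_slide. Qed.

Lemma evacuate_slide s b s' :
  slide s = b :: s' -> evacuate s = b :: evacuate s'.
Proof.
move=> e; have := size_slide s; rewrite e /= => e2.
by rewrite /evacuate -e2 /= e.
Qed.

Lemma unslideK s : slide (unslide s) = s.
Proof.
case: s => // x s; elim: s x => // y s IHs x; rewrite unslide_cons.
by case: ifP => A; cbn [slide]; rewrite IHs /= ?A // neighbour_diagonalsC A.
Qed.

Lemma slide_nil_cons s : s = [::] \/ exists b s', slide s = b :: s'.
Proof.
have := size_slide s.
by case: (slide s) => [|b s'] e; [left; case: s e | right; exists b, s'].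
Qed.

Lemma perm_evacuate s : perm_eq (evacuate s) s.
Proof.
have [n] := ubnP (size s); elim: n s => // n IHn s le_s.
have [->//|[b [s' e]]] := slide_nil_cons s.
rewrite (evacuate_slide e); apply: perm_trans (perm_slide s); rewrite e.
by rewrite perm_cons IHn //; have := size_slide s; rewrite e /=; lia.
Qed.

Lemma size_evacuate s : size (evacuate s) = size s.
Proof. exact/perm_size/perm_evacuate. Qed.

(** Evacuation is the product, for i decreasing, of the runs t_i ... t_m of toggles.
    The leftmost factor of a run commutes with all the factors of the runs to its
    left except their leftmost ones, so the leftmost factors can be collected in
    front: they form a slide in reverse, and the rest is the evacuation of
    [s]. *)
Lemma evacuate_cons x s : evacuate (x :: s) = unslide (x :: evacuate s).
Proof.
have [n] := ubnP (size s); elim: n x s => // n IHn x s le_s.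
have [->//|[y [s' e]]] := slide_nil_cons s.
have lt_s' : size s' < n by have := size_slide s; rewrite e /=; lia.
rewrite (evacuate_slide e) unslide_cons.
have e1 : slide (x :: s) =
    if neighbour_diagonals x y then [:: x, y & s'] else [:: y, x & s'].
  by rewrite /= e.
by case: ifP e1 => A e1; rewrite (evacuate_slide e1) IHn.
Qed.

Lemma evacuateK s : evacuate (evacuate s) = s.
Proof.
elim: s => // x s IHs; rewrite evacuate_cons.
by rewrite (evacuate_slide (unslideK _)) IHs.
Qed.

(** * Saturated chains of order ideals *)
Definition supported (D : seq box) (b : box) : bool :=
  [&& 0 < b.1, 0 < b.2, (b.1 == 1) || (north b \in D)
    & (b.2 == 1) || (west b \in D)].

Definition ideal (D : seq box) : bool := all (supported D) D.

(** The list [s] enumerates a skew standard tableau whose inner shape is the set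
    of boxes of [D]: adding its boxes one by one to [D] keeps an order ideal. *)
Fixpoint chain (D s : seq box) : bool :=
  ideal D && (if s is b :: s' then (b \notin D) && chain (b :: D) s' else true).

Lemma eq_ideal D D' : D =i D' -> ideal D = ideal D'.
Proof.
move=> e; rewrite /ideal (eq_all_r e); apply: eq_all => b.
by rewrite /supported !e.
Qed.

Lemma eq_chain D D' s : D =i D' -> chain D s = chain D' s.
Proof.
elim: s D D' => [|b s IHs] D D' e /=; rewrite (eq_ideal e) // e.
by rewrite (IHs (b :: D) (b :: D')) // => c; rewrite !inE e.
Qed.

Lemma chain_ideal D s : chain D s -> ideal D.
Proof. by case: s => [|b s] /= /andP[]. Qed.

Lemma chain_behead D x s : chain D (x :: s) -> chain (x :: D) s.
Proof. by case/and3P. Qed.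

Lemma chain_cat D s t : chain D (s ++ t) = chain D s && chain (s ++ D) t.
Proof.
elim: s D => [|b s IHs] D /=.
  by case: (ideal D) (@chain_ideal D t) => //; case: chain => // /(_ isT).
rewrite IHs -!andbA; do 2!congr (_ && _); congr (_ && _).
by apply: eq_chain => c; rewrite inE !mem_cat inE orbCA.
Qed.

Lemma ideal_pos D (b : box) : ideal D -> b \in D -> 0 < b.1 /\ 0 < b.2.
Proof. by move=> /allP ID /ID /and4P[]. Qed.

Lemma ideal_le D (b : box) i j : ideal D -> b \in D -> 0 < i <= b.1 -> 0 < j <= b.2 ->
  (i, j) \in D.
Proof.
move=> ID; have [n] := ubnP (b.1 + b.2).
elim: n b i j => // n IHn [r c] i j le_n bD /= /andP[i0 ir] /andP[j0 jc].
have /and4P[/= r0 c0 nD wD] := allP ID _ bD.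
have [e1|n1] := eqVneq i r; have [e2|n2] := eqVneq j c; first by rewrite e1 e2.
- have := wD; rewrite (_ : (c == 1) = false) /=; last by apply/negbTE; lia.
  by move=> wD'; apply: (IHn (r, c.-1)) => //=; rewrite /= in le_n; lia.
- have := nD; rewrite (_ : (r == 1) = false) /=; last by apply/negbTE; lia.
  by move=> wD'; apply: (IHn (r.-1, c)) => //=; rewrite /= in le_n; lia.
- have := nD; rewrite (_ : (r == 1) = false) /=; last by apply/negbTE; lia.
  by move=> wD'; apply: (IHn (r.-1, c)) => //=; rewrite /= in le_n; lia.
Qed.

(** Between two boxes of one diagonal an order ideal has to acquire the boxes
    to the east and to the south of the first one. *)
Lemma same_diagonal_between D E F (x y : box) : ideal D -> ideal E -> ideal F ->
  x \notin D -> x \in E -> y \notin E -> y \in F -> content x = content y ->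
  [/\ (x.1, x.2.+1) \in F, (x.1.+1, x.2) \in F,
     (x.1, x.2.+1) \notin D & (x.1.+1, x.2) \notin D].
Proof.
case: x y => [r c] [r' c'] ID IE IF xD xE yE yF; rewrite /content /= => e.
have [/= p1 p2] := ideal_pos IE xE; have [/= p3 p4] := ideal_pos IF yF.
have lt_r : r < r'.
  rewrite ltnNge; apply/negP => le_r; move/negP: yE; apply.
  by apply: (ideal_le IE xE) => /=; lia.
split; try by [apply: (ideal_le IF yF) => /=; lia].
- by apply: contra xD => bD; apply: (ideal_le ID bD) => /=; lia.
- by apply: contra xD => bD; apply: (ideal_le ID bD) => /=; lia.
Qed.

Lemma content_neq2 D x y s : chain D [:: x, y & s] -> content x != content y.
Proof.
move=> /=/and5P[ID xD IE yE /chain_ideal IF]; apply/eqP => e.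
have [] := same_diagonal_between ID IE IF xD (mem_head _ _) yE (mem_head _ _) e.
rewrite !inE => /or3P[/eqP b|/eqP b|->//] _; last by case: (x) b => ? ? []; lia.
by move: e; rewrite -b /content /=; lia.
Qed.

Lemma content_neq3 D x y z s :
  chain D [:: x, y, z & s] -> content x != content z.
Proof.
move=> /=/and5P[ID xD IE yE /and3P[IF zF /chain_ideal IG]]; apply/eqP => e.
have xF : x \in [:: y, x & D] by rewrite !inE eqxx orbT.
have [] := same_diagonal_between ID IF IG xD xF zF (mem_head _ _) e.
rewrite !inE; case: x y z e {ID xD IE yE IF zF IG xF} => [a b] [c d] [u v].
rewrite /content /= !xpair_eqE => e H1 H2 /negPf N1 /negPf N2; move: H1 H2.
rewrite N1 N2.
by rewrite !orbF; lia.
Qed.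

(** The 2 by 2 squares are the only way in which a diagonal comes back after
    three steps. *)
Lemma content_eq4 D x y z h s :
  chain D [:: x, y, z, h & s] -> content x = content h ->
  (content y = content x + 1 /\ content z = content x - 1
   \/ content z = content x + 1 /\ content y = content x - 1)%R.
Proof.
move=> /=/and5P[ID xD IE yE /and5P[IF zF IG hG /chain_ideal IH]] e.
have xG : x \in [:: z, y, x & D] by rewrite !inE eqxx !orbT.
have [] := same_diagonal_between ID IG IH xD xG hG (mem_head _ _) e.
rewrite !inE; move: x y z h e {ID xD IE yE IF zF IG xG IH hG}.
move=> [a b] [c d] [u v] [i j].
rewrite /content /= !xpair_eqE => e H1 H2 /negPf N1 /negPf N2; move: H1 H2.
rewrite N1 N2.
by rewrite !orbF; lia.
Qed.

Lemma chain_adjacent D x y s : chain D [:: x, y & s] ->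
  neighbour_diagonals x y -> x = north y \/ x = west y.
Proof.
case: x y => [r c] [r' c'].
move=> /=/and5P[ID xD IE yE /chain_ideal IF].
have [/= p1 p2] := ideal_pos IE (mem_head _ _).
have [/= p3 p4] := ideal_pos IF (mem_head _ _).
have Nle : ~~ ((r' <= r) && (c' <= c)).
  by apply: contra yE => H; apply: (ideal_le IE (mem_head _ _)) => /=; lia.
have /and4P[_ _ /= nF wF] := allP IF _ (mem_head _ _).
rewrite /neighbour_diagonals /content /= => adj.
have [e|e] : c' + r = c + r' + 1 \/ c' + r + 1 = c + r' by lia.
- right; move: wF; rewrite !inE /west /= !xpair_eqE => /or4P[|||H]; try lia.
    by move=> /andP[/eqP-> /eqP->].
  exfalso; have [h|h] := leqP r r'; last by lia.
  have [h1|h1] := eqVneq r r'; last first.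
    by move/negP: xD; apply; apply: (ideal_le ID H) => /=; lia.
  by move/negP: xD; apply; apply: (ideal_le ID H) => /=; lia.
- left; move: nF; rewrite !inE /north /= !xpair_eqE => /or4P[|||H]; try lia.
    by move=> /andP[/eqP-> /eqP->].
  by exfalso; move/negP: xD; apply; apply: (ideal_le ID H) => /=; lia.
Qed.

Lemma chain_toggle D s : chain D s -> chain D (toggle s).
Proof.
case: s => [|x [|y s]] //= /and5P[ID xD IE yE cF].
case: ifP => A /=; first by rewrite ID xD IE yE cF.
have IF := chain_ideal cF.
have nyx : y != x by move: yE; rewrite inE; case: eqVneq.
have yD : y \notin D by move: yE; rewrite inE; case: (y \in D); rewrite ?orbT.
rewrite ID yD /=; apply/and3P; split.
- apply/allP => b; rewrite inE => /orP[/eqP->|bD]; last first.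
    have := allP ID _ bD; rewrite /supported !inE.
    by case/and4P=> -> -> /orP[->|->] /orP[->|->]; rewrite ?orbT.
  have /and4P[p1 p2] := allP IF _ (mem_head _ _).
  rewrite /supported p1 p2 /= !inE => n w; apply/andP; split.
    case/or4P: n => [->//|->|/eqP e|->]; rewrite ?orbT //.
    by move: A p1; rewrite -e /neighbour_diagonals /content /=; clear; lia.
  case/or4P: w => [->//|->|/eqP e|->]; rewrite ?orbT //.
  by move: A p2; rewrite -e /neighbour_diagonals /content /=; clear; lia.
- by rewrite inE eq_sym (negPf nyx).
- by rewrite (@eq_chain _ (y :: x :: D)) // => b; rewrite !inE orbCA.
Qed.

Lemma chain_slide D s : chain D s -> chain D (slide s).
Proof.
elim: s D => // x s IHs D /and3P[ID xD /IHs cs].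
by apply: (@chain_toggle D (x :: slide s)); rewrite /= ID xD.
Qed.

Lemma chain_evacuate D s : chain D s -> chain D (evacuate s).
Proof.
have [n] := ubnP (size s); elim: n D s => // n IHn D s le_s cs.
have [e|[b [s' e]]] := slide_nil_cons s; first by rewrite e in cs *.
rewrite (evacuate_slide e); move: (chain_slide cs); rewrite e /=.
case/and3P=> -> -> /IHn -> //.
by have := size_slide s; rewrite e /=; lia.
Qed.

(** * Elementary dual equivalence and descents *)

(** The first argument is the box in the middle. *)
Definition between (b a c : box) : bool :=
  ((content a < content b < content c) || (content c < content b < content a))%R.

(** Haiman's elementary dual equivalence on the first three boxes.  In terms of
    the words of row indices it is a Knuth relation. *)
Definition dual (s : seq box) : seq box :=
  if s is [:: x, y, z & s'] then
    if between x y z then [:: x, z, y & s']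
    else if between z x y then [:: y, x, z & s']
    else s
  else s.

Definition descent (s : seq box) : bool :=
  if s is [:: x, y & _] then (content y < content x)%R else false.

Definition act_at (i : nat) (f : seq box -> seq box) (s : seq box) : seq box :=
  take i s ++ f (drop i s).

Lemma act_at_cons i f x s : act_at i.+1 f (x :: s) = x :: act_at i f s.
Proof. by []. Qed.

Lemma toggle_cons x y s : toggle [:: x, y & s] =
  if neighbour_diagonals x y then [:: x, y & s] else [:: y, x & s].
Proof. by []. Qed.

Lemma dual_cons x y z s : dual [:: x, y, z & s] =
  if between x y z then [:: x, z, y & s]
  else if between z x y then [:: y, x, z & s] else [:: x, y, z & s].
Proof. by []. Qed.

(** The heart of the proof: a box [h] that travels past three boxes does not see
    the difference between a triple and its dual equivalent, and leaves behind
    dual equivalent triples.  The hypotheses are those satisfied by the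
    diagonals of four consecutive boxes of a chain, and the identity is then a
    finite check on the relative order of four integers. *)
Lemma toggles_dual x y z h s :
  content x != content y -> content x != content z -> content y != content z ->
  content y != content h -> content z != content h ->
  (content x = content h ->
  (content y = content x + 1 /\ content z = content x - 1
   \/ content z = content x + 1 /\ content y = content x - 1)%R) ->
  let pass x y z := toggle (x :: toggle (y :: toggle [:: z, h & s])) in
  (if between x y z then pass x z y else if between z x y then pass y x z
    else pass x y z) =
  act_at 1 dual (pass x y z).
Proof.
move=> Nxy Nxz Nyz Nyh Nzh Exh pass; rewrite /pass {pass}.
repeat match goal with
| |- context [if between ?a ?b ?c then _ else _] =>
  let E := fresh in case E: (between a b c); rewrite /between in E
| |- context [toggle (?a :: ?b :: ?t)] => rewrite (toggle_cons a b t);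
  let E := fresh in case E: (neighbour_diagonals a b); rewrite /neighbour_diagonals in E
| |- context [act_at 1 dual (?a :: ?b :: ?c :: ?d :: ?t)] =>
  rewrite (act_at_cons 0 dual) /act_at take0 drop0 cat0s (dual_cons b c d t)
end; try reflexivity; try (exfalso; lia).
Qed.

Lemma slide_dual D x y z s : chain D [:: x, y, z & s] -> s != [::] ->
  slide (dual [:: x, y, z & s]) = act_at 1 dual (slide [:: x, y, z & s]).
Proof.
move=> cs s0; have [e|[h [s1 e]]] := slide_nil_cons s; first by rewrite e in s0.
have {}cs : chain D [:: x, y, z, h & s1].
  move: (cs : chain D ([:: x; y; z] ++ s)); rewrite chain_cat.
  case/andP=> c1 /chain_slide c2; rewrite e in c2.
  by have : chain D ([:: x; y; z] ++ h :: s1) by rewrite chain_cat c1.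
have Nxy := content_neq2 cs; have Nxz := content_neq3 cs.
have Exh := content_eq4 cs.
have {}cs := chain_behead cs.
have Nyz := content_neq2 cs; have Nyh := content_neq3 cs.
have {}cs := chain_behead cs.
have Nzh := content_neq2 cs => {cs}.
have slide3 u v w : slide [:: u, v, w & s] =
    toggle (u :: toggle (v :: toggle [:: w, h & s1])) by rewrite -e.
rewrite slide3 -toggles_dual // dual_cons.
by do 2?[case: ifP => _]; rewrite slide3.
Qed.

Lemma slide_act_dual D i s : chain D s -> i + 3 < size s ->
  slide (act_at i dual s) = act_at i.+1 dual (slide s).
Proof.
elim: i D s => [|i IHi] D [|x s] //.
  case: s => [|y [|z s]] // cs; rewrite /act_at take0 drop0 cat0s => lt_s.
  by rewrite (slide_dual cs) //; case: s lt_s {cs}.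
case/and3P=> ID xD cs; rewrite addSn => lt_s.
rewrite act_at_cons -[slide (_ :: _)]/(toggle (x :: slide _)) (IHi _ _ cs) //.
have [e|[y [s1 e]]] := slide_nil_cons s; first by rewrite e in lt_s.
rewrite -[slide (x :: s)]/(toggle (x :: slide s)) e act_at_cons !toggle_cons.
by case: ifP.
Qed.

(** A box that travels past two others preserves which of the two lies lower. *)
Lemma slide_descent D x y s : chain D [:: x, y & s] -> s != [::] ->
  descent (behead (slide [:: x, y & s])) = descent [:: x, y & s].
Proof.
move=> cs s0; have [e|[h [s1 e]]] := slide_nil_cons s; first by rewrite e in s0.
have {}cs : chain D [:: x, y, h & s1].
  move: (cs : chain D ([:: x; y] ++ s)); rewrite chain_cat.
  case/andP=> c1 /chain_slide c2; rewrite e in c2.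
  by have : chain D ([:: x; y] ++ h :: s1) by rewrite chain_cat c1.
have Nxy := content_neq2 cs; have Nxz := content_neq3 cs.
have {}cs := chain_behead cs.
have Nyz := content_neq2 cs.
rewrite -[slide _]/(toggle (x :: toggle (y :: slide s))) e !toggle_cons.
by do 2![case: ifP; rewrite ?toggle_cons]; rewrite /neighbour_diagonals /=; lia.
Qed.

Lemma slide_act_descent D i s : chain D s -> i + 2 < size s ->
  descent (drop i.+1 (slide s)) = descent (drop i s).
Proof.
elim: i D s => [|i IHi] D [|x s] //.
  case: s => [|y s] // cs lt_s.
  by rewrite drop0 drop1 (slide_descent cs) //; case: s lt_s {cs}.
case/and3P=> ID xD cs; rewrite addSn => lt_s.
rewrite -[drop i.+1 (x :: s)]/(drop i s) -(IHi _ _ cs) //.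
have [e|[y [s1 e]]] := slide_nil_cons s; first by rewrite e in lt_s.
rewrite -[slide (x :: s)]/(toggle (x :: slide s)) e toggle_cons.
by case: ifP.
Qed.

(** * Evacuation at the end of a rectangle *)
Definition in_rectangle (a c : nat) (b : box) : bool :=
  (0 < b.1 <= a) && (0 < b.2 <= c).

Definition fills_rectangle (a c : nat) (s : seq box) : Prop :=
  forall b : box, in_rectangle a c b = (b \in s).

(** Only the corner of the rectangle can come last, and any other box is followed
    by its east or south neighbour. *)
Lemma rectangle_later a c D (x : box) s : fills_rectangle a c ((x :: s) ++ D) ->
  chain D (x :: s) -> s != [::] ->
  exists2 y, y \in s & neighbour_diagonals x y.
Proof.
move=> eqR /and3P[ID xD cs] s0.
have ICx : ideal (x :: D) := chain_ideal cs.
have [x1 x2] := ideal_pos ICx (mem_head _ _).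
have inR b : in_rectangle a c b = (b \in x :: s ++ D) by exact: eqR.
have: in_rectangle a c x by rewrite inR mem_head.
have later b : in_rectangle a c b -> b != x -> ~~ (b \in D) -> b \in s.
  by rewrite inR inE mem_cat => /or3P[->|->|->].
rewrite /in_rectangle => Rx.
have [lt_r|ge_r] := ltnP x.1 a.
  exists (x.1.+1, x.2); last by rewrite /neighbour_diagonals /content /=; lia.
  apply: later => /=; first by rewrite /in_rectangle /=; lia.
    by apply/eqP => /(congr1 (fun b : box => b.1 + b.2)) /=; lia.
  apply: contra xD => bD; rewrite [x]surjective_pairing.
  by apply: (ideal_le ID bD) => /=; lia.
have [lt_c|ge_c] := ltnP x.2 c.
  exists (x.1, x.2.+1); last by rewrite /neighbour_diagonals /content /=; lia.
  apply: later => /=; first by rewrite /in_rectangle /=; lia.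
    by apply/eqP => /(congr1 (fun b : box => b.1 + b.2)) /=; lia.
  apply: contra xD => bD; rewrite [x]surjective_pairing.
  by apply: (ideal_le ID bD) => /=; lia.
exfalso; case: s s0 cs eqR inR {later} => // b s _ /and3P[_ bxD _] eqR inR.
have: in_rectangle a c b by rewrite inR !inE eqxx orbT.
rewrite /in_rectangle => Rb; move/negP: bxD; apply.
by rewrite [b]surjective_pairing; apply: (ideal_le ICx (mem_head _ _)) => /=; lia.
Qed.

(** The last box is the corner and the one before it is a neighbour of it, so
    the only toggle is blocked. *)
Lemma evacuate_pair a c D x y : fills_rectangle a c ([:: x; y] ++ D) ->
  chain D [:: x; y] -> evacuate [:: x; y] = [:: x; y].
Proof.
move=> eqR cs; have [] := rectangle_later eqR cs isT.
by move=> b; rewrite inE => /eqP-> A; rewrite /evacuate /= A.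
Qed.

(** The last two boxes are adjacent. Hence evacuation of the last three reduces to
    the toggle of the first two, which here coincides with the dual
    equivalence. *)
Lemma evacuate_triple a c D x y z : fills_rectangle a c ([:: x; y; z] ++ D) ->
  chain D [:: x; y; z] ->
  evacuate (dual [:: x; y; z]) = dual (evacuate [:: x; y; z]).
Proof.
move=> eqR cs.
have Nxz := content_neq3 cs.
have [b bs Ax] := rectangle_later eqR cs isT.
have {}Ax : neighbour_diagonals x y || neighbour_diagonals x z.
  by move: bs Ax; rewrite !inE => /orP[/eqP->|/eqP->] ->; rewrite ?orbT.
have {}cs := chain_behead cs.
have eqR' : fills_rectangle a c ([:: y; z] ++ (x :: D)).
  by move=> d; rewrite eqR !inE orbCA; congr (_ || _); rewrite orbCA.
have [b' ] := rectangle_later eqR' cs isT; rewrite inE => /eqP-> Ayz {b' b bs}.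
have e3 u v w : evacuate [:: u; v; w] =
    if neighbour_diagonals v w then
      if neighbour_diagonals u v then u :: evacuate [:: v; w]
      else v :: evacuate [:: u; w]
    else
      if neighbour_diagonals u w then u :: evacuate [:: w; v]
      else w :: evacuate [:: u; v].
  by case: ifP => A; case: ifP => B; apply: evacuate_slide; rewrite /= A /= B.
have e2 u v : evacuate [:: u; v] =
   if neighbour_diagonals u v then [:: u; v] else [:: v; u].
  by rewrite /evacuate /=; case: ifP.
repeat match goal with
| |- context [dual [:: ?a; ?b; ?c]] => rewrite (dual_cons a b c [::])
| |- context [if between ?a ?b ?c then _ else _] =>
  let E := fresh in case E: (between a b c); rewrite /between in E
| |- context [evacuate [:: ?a; ?b; ?c]] => rewrite (e3 a b c)
| |- context [evacuate [:: ?a; ?b]] => rewrite (e2 a b)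
| |- context [if neighbour_diagonals ?a ?b then _ else _] =>
  let E := fresh in case E: (neighbour_diagonals a b); rewrite /neighbour_diagonals in E
end; try reflexivity; rewrite /neighbour_diagonals in Ax Ayz; try (exfalso; lia).
Qed.

Lemma act_at0 f s : act_at 0 f s = f s.
Proof. by rewrite /act_at take0 drop0. Qed.

Lemma slide_rectangle a c D s b s' : fills_rectangle a c (s ++ D) ->
  slide s = b :: s' -> fills_rectangle a c (s' ++ b :: D).
Proof.
move=> eqR e d; rewrite eqR !mem_cat -(perm_mem (perm_slide s)) e !inE.
by rewrite -orbA orbCA.
Qed.

(** The slides push the dual equivalence towards the end of the list.  If it acts
    there from the start, nothing can be pushed; but evacuation is an
    involution, so this case is the inverse of the one where it acts on the
    first three boxes.  Only lists of length three need the rectangle. *)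
Lemma evacuate_act_dual a c D s i : fills_rectangle a c (s ++ D) ->
  chain D s -> i + 3 <= size s ->
  evacuate (act_at i dual s) = act_at (size s - 3 - i) dual (evacuate s).
Proof.
have [n] := ubnP (size s); elim: n D s i => // n IHn D s i.
rewrite ltnS => le_n eqR cs le_i.
have below t j : size t = size s -> fills_rectangle a c (t ++ D) ->
    chain D t -> j + 3 < size t ->
    evacuate (act_at j dual t) = act_at (size t - 3 - j) dual (evacuate t).
  move=> est eqRt ct lt_j.
  have [e|[b [t' e]]] := slide_nil_cons t; first by rewrite e in lt_j.
  have et' : size t = (size t').+1 by rewrite -(size_slide t) e.
  have ct' : chain (b :: D) t' by move: (chain_slide ct); rewrite e => /and3P[].
  have := slide_act_dual ct lt_j; rewrite e act_at_cons => e2.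
  rewrite (evacuate_slide e) (evacuate_slide e2).
  rewrite (IHn (b :: D)) //; try lia.
    by rewrite (_ : size t - 3 - j = (size t' - 3 - j).+1) //; lia.
  exact: slide_rectangle eqRt e.
have [lt_i|ge_i] := ltnP (i + 3) (size s); first exact: below.
have -> : size s - 3 - i = 0 by lia.
(* The dual equivalence acts on the last three boxes. *)
have [e3|n3] := eqVneq (size s) 3.
  have -> : i = 0 by lia.
  rewrite !act_at0; case: s e3 eqR cs {below le_n le_i ge_i} => [|x [|y [|z [|]]]] // _.
  exact: evacuate_triple.
have eqRe : fills_rectangle a c (evacuate s ++ D).
  by move=> d; rewrite eqR !mem_cat (perm_mem (perm_evacuate s)).
have := below (evacuate s) 0 (size_evacuate s) eqRe (chain_evacuate cs).
rewrite evacuateK size_evacuate => /(_ _)/(congr1 evacuate).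
rewrite evacuateK => ->; last by lia.
by congr (evacuate (act_at _ _ _)); lia.
Qed.

(** The same argument as for dual equivalences, with pairs in place of triples. *)
Lemma evacuate_descent a c D s i : fills_rectangle a c (s ++ D) ->
  chain D s -> i + 2 <= size s ->
  descent (drop (size s - 2 - i) (evacuate s)) = descent (drop i s).
Proof.
have [n] := ubnP (size s); elim: n D s i => // n IHn D s i.
rewrite ltnS => le_n eqR cs le_i.
have below t j : size t = size s -> fills_rectangle a c (t ++ D) ->
    chain D t -> j + 2 < size t ->
    descent (drop (size t - 2 - j) (evacuate t)) = descent (drop j t).
  move=> est eqRt ct lt_j.
  have [e|[b [t' e]]] := slide_nil_cons t; first by rewrite e in lt_j.
  have et' : size t = (size t').+1 by rewrite -(size_slide t) e.
  have ct' : chain (b :: D) t' by move: (chain_slide ct); rewrite e => /and3P[].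
  rewrite -(slide_act_descent ct lt_j) e (evacuate_slide e) /=.
  rewrite -(IHn (b :: D) t' j) //; try lia.
    by rewrite (_ : size t - 2 - j = (size t' - 2 - j).+1) //; lia.
  exact: slide_rectangle eqRt e.
have [lt_i|ge_i] := ltnP (i + 2) (size s); first exact: below.
have -> : size s - 2 - i = 0 by lia.
have [e2|n2] := eqVneq (size s) 2.
  have -> : i = 0 by lia.
  rewrite !drop0; case: s e2 eqR cs {below le_n le_i ge_i} => [|x [|y [|]]] // _.
  by move=> eqR cs; rewrite (evacuate_pair eqR cs).
have eqRe : fills_rectangle a c (evacuate s ++ D).
  by move=> d; rewrite eqR !mem_cat (perm_mem (perm_evacuate s)).
have := below (evacuate s) 0 (size_evacuate s) eqRe (chain_evacuate cs).
rewrite evacuateK size_evacuate => <-; last by lia.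
by congr (descent (drop _ _)); lia.
Qed.

(** * Transitivity of elementary dual equivalence *)
Lemma chain_uniq D s : chain D s -> uniq s /\ (forall b, b \in s -> b \notin D).
Proof.
elim: s D => //= x s IHs D /and3P[_ xD /IHs[Us H]]; split.
  by rewrite Us andbT; apply/negP => /H; rewrite mem_head.
move=> b; rewrite inE => /orP[/eqP->//|/H].
by rewrite inE negb_or => /andP[].
Qed.

Lemma chain_rcons s p : chain [::] (rcons s p) ->
  [/\ chain [::] s, p \notin s & ideal (rcons s p)].
Proof.
rewrite -cats1 chain_cat cats0 /= => /andP[cs /and3P[_ ps Ips]]; split=> //.
rewrite andbT in Ips.
by rewrite (@eq_ideal _ (p :: s)) // => b; rewrite mem_cat !inE orbC.
Qed.

Lemma chain_total_ideal s : chain [::] s -> ideal s.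
Proof. by rewrite -[s]cats0 chain_cat cats0 => /andP[_ /chain_ideal]. Qed.

(** A dual equivalence is a toggle that is not blocked; which of the two toggles it
    is depends on the triple. *)
Lemma dual_toggle s :
  [\/ dual s = s, dual s = toggle s
  | exists x s', s = x :: s' /\ dual s = x :: toggle s'].
Proof.
case: s => [|x [|y [|z s]]]; try by constructor 1.
rewrite dual_cons; case: ifP => [B|_].
  constructor 3; exists x, [:: y, z & s]; split=> //; rewrite toggle_cons.
  by move: B; rewrite /between; case: ifP => //; rewrite /neighbour_diagonals; lia.
case: ifP => [B|_]; last by constructor 1.
constructor 2; rewrite toggle_cons.
by move: B; rewrite /between; case: ifP => //; rewrite /neighbour_diagonals; lia.
Qed.

Lemma perm_dual s : perm_eq (dual s) s.
Proof.
have [->|->|[x [s' [-> ->]]]] := dual_toggle s; rewrite ?perm_toggle //.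
by rewrite perm_cons perm_toggle.
Qed.

Lemma chain_dual D s : chain D s -> chain D (dual s).
Proof.
have [->|->|[x [s' [-> ->]]]] // := dual_toggle s; first exact: chain_toggle.
by case/and3P=> ID xD cs'; rewrite /= ID xD chain_toggle.
Qed.

Lemma perm_act_dual i s : perm_eq (act_at i dual s) s.
Proof. by rewrite -{2}(cat_take_drop i s) perm_cat2l perm_dual. Qed.

Lemma chain_act_dual D i s : chain D s -> chain D (act_at i dual s).
Proof.
rewrite -{1}(cat_take_drop i s) !chain_cat => /andP[-> cs].
exact: chain_dual.
Qed.

Lemma dual_cat s t : 3 <= size s -> dual (s ++ t) = dual s ++ t.
Proof.
by case: s => [|x [|y [|z s]]] // _; rewrite !dual_cons; do 2?[case: ifP].
Qed.

Lemma act_dual_rcons i s p : i + 3 <= size s ->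
  act_at i dual (rcons s p) = rcons (act_at i dual s) p.
Proof.
move=> le_i; rewrite /act_at -cats1 takel_cat; last by lia.
rewrite drop_cat ifT; last by lia.
by rewrite dual_cat ?size_drop; [rewrite catA cats1|lia].
Qed.

Lemma chain_filter (P : pred box) D s : chain D s ->
  (forall b, b \in s ++ D -> P b ->
     (1 < b.1 -> P (north b)) /\ (1 < b.2 -> P (west b))) ->
  chain (filter P D) (filter P s).
Proof.
have ideal_filter E : ideal E ->
    (forall b, b \in E -> P b ->
     (1 < b.1 -> P (north b)) /\ (1 < b.2 -> P (west b))) ->
    ideal (filter P E).
  move=> IE H; apply/allP => b; rewrite mem_filter => /andP[Pb bE].
  have /and4P[b1 b2 n w] := allP IE _ bE; have [Hn Hw] := H _ bE Pb.
  rewrite /supported b1 b2 !mem_filter /=; apply/andP; split.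
    by case/orP: n => [->//|->]; case: (ltngtP b.1 1) b1 Hn => // _ _ ->.
  by case/orP: w => [->//|->]; case: (ltngtP b.2 1) b2 Hw => // _ _ ->.
elim: s D => [|x s IHs] D /=; first by rewrite !andbT => ID H; apply: ideal_filter.
case/and3P=> ID xD cs H.
have IfD : ideal (filter P D).
  by apply: ideal_filter => // b bD; apply: H; rewrite inE mem_cat bD !orbT.
have {IHs} : chain (filter P (x :: D)) (filter P s).
  apply: IHs => // b bs; apply: H.
  by rewrite !inE !mem_cat !inE in bs *; rewrite orbCA.
rewrite /=; case: ifP => // Px /= ->.
by rewrite IfD mem_filter (negPf xD) andbF.
Qed.

Lemma exists_maximal (f : box -> nat) (s : seq box) x : x \in s ->
  exists2 z : box, z \in s & forall y : box, y \in s -> f y <= f z.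
Proof.
elim: s x => // a [|b s] IHs x _.
  by exists a; rewrite ?inE // => y; rewrite inE => /eqP->.
have [z zs H] := IHs b (mem_head _ _).
have [le|lt] := leqP (f a) (f z).
  by exists z; [rewrite inE zs orbT|move=> y; rewrite inE => /orP[/eqP->|/H]].
exists a; first exact: mem_head.
move=> y; rewrite inE => /orP[/eqP->//|/H le]; apply: leq_trans le _; exact: ltnW.
Qed.

Lemma ideal_sub_le D (x y : box) : ideal D -> y \in D -> 0 < x.1 <= y.1 ->
  0 < x.2 <= y.2 -> x \in D.
Proof. by case: x => i j ID yD; apply: (ideal_le ID yD). Qed.

Lemma betweenC a b c : between b a c = between b c a.
Proof. by rewrite /between orbC. Qed.

(** Two corners [p] and [q] of a shape can be removed last in both orders, and a
    third box [z] can be removed just before them whose diagonal lies strictly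
    between theirs: the end of the row above the lower corner.  The two
    lists that end in [z; p; q] and [z; q; p] are then dual equivalent. *)
Lemma corner_bridge s t p q : chain [::] (rcons s p) -> chain [::] (rcons t q) ->
  perm_eq (rcons s p) (rcons t q) -> p != q ->
  exists u z, [/\ chain [::] (u ++ [:: z; p; q]), chain [::] (u ++ [:: z; q; p]),
    perm_eq (u ++ [:: z; q; p]) (rcons s p) & between z p q].
Proof.
move=> csp ctq; wlog lt_pq : p q s t csp ctq / p.1 < q.1.
  move=> H st npq.
  have [lt|gt|e] := ssrnat.ltngtP p.1 q.1; first exact: (H p q s t).
    have ts : perm_eq (rcons t q) (rcons s p) by rewrite perm_sym.
    have nqp : q != p by rewrite eq_sym.
    have [u [z [c1 c2 pe B]]] := H q p t s ctq csp gt ts nqp; exists u, z; split=> //.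
      rewrite perm_sym; apply: (perm_trans st); rewrite perm_sym.
      apply: perm_trans pe; rewrite perm_cat2l.
      by rewrite !perm_cons -[[:: q; p]]/([:: q] ++ [:: p]) perm_catC.
    by rewrite betweenC.
  exfalso.
  have [cs ps Isp] := chain_rcons csp; have [ct qt Itq] := chain_rcons ctq.
  have Is := chain_total_ideal cs; have It := chain_total_ideal ct.
  have qs : q \in s.
    by have := perm_mem st q; rewrite !mem_rcons !inE eqxx eq_sym (negPf npq) => /= ->.
  have pt : p \in t.
    by have := perm_mem st p; rewrite !mem_rcons !inE eqxx (negPf npq) => /= <-.
  have [q1 q2] := ideal_pos Is qs; have [p1 p2] := ideal_pos It pt.
  have [le|le] := leqP p.2 q.2.
    by move/negP: ps; apply; apply: (ideal_sub_le Is qs);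
      apply/andP; split; rewrite // e.
  by move/negP: qt; apply; apply: (ideal_sub_le It pt);
    apply/andP; split; rewrite ?e // ltnW.
move=> st npq.
have [cs ps Isp] := chain_rcons csp; have [ct qt Itq] := chain_rcons ctq.
have Is := chain_total_ideal cs; have It := chain_total_ideal ct.
have [Usp _] := chain_uniq csp.
have eA := perm_mem st.
have qs : q \in s.
  by have := eA q; rewrite !mem_rcons !inE eqxx eq_sym (negPf npq) => /= ->.
have pt : p \in t.
  by have := eA p; rewrite !mem_rcons !inE eqxx (negPf npq) => /= <-.
have [q1 q2] := ideal_pos Is qs; have [p1 p2] := ideal_pos It pt.
set A := rcons s p in csp st Isp Usp eA *.
have inA (b : box) : (b \in A) = (b == p) || (b \in s) by rewrite mem_rcons inE.
have inA' (b : box) : (b \in A) = (b == q) || (b \in t) by rewrite eA mem_rcons inE.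
have maxp (b : box) : b \in A -> p.1 <= b.1 -> p.2 <= b.2 -> b = p.
  rewrite inA => /orP[/eqP//|bs] l1 l2.
  by move/negP: ps; case; apply: (ideal_sub_le Is bs); apply/andP.
have maxq (b : box) : b \in A -> q.1 <= b.1 -> q.2 <= b.2 -> b = q.
  rewrite inA' => /orP[/eqP//|bt] l1 l2.
  by move/negP: qt; case; apply: (ideal_sub_le It bt); apply/andP.
have pA : p \in A by rewrite inA eqxx.
have qA : q \in A by rewrite inA' eqxx.
have lt_qp : q.2 < p.2.
  rewrite ltnNge; apply/negP => le; have e := maxp _ qA (ltnW lt_pq) le.
  by rewrite e eqxx in npq.
(* [z] is the rightmost box of the row above [q] other than [p]; the search set
   contains the north neighbour of [q]. *)
pose Pz (b : box) := [&& b != p, b != q, q.1.-1 <= b.1 & q.2 <= b.2].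
have northA : (q.1.-1, q.2) \in filter Pz A.
  have lt1 : 0 < q.1.-1 by move: p1 lt_pq; clear; lia.
  rewrite mem_filter /Pz /= !leqnn (ideal_le Isp qA) ?lt1 ?q2 ?leq_pred //=.
  rewrite !andbT; apply/andP; split; apply/eqP => e.
    by move: lt_qp; rewrite -e ltnn.
  by move: (congr1 fst e) lt1 => /=; clear; lia.
have [z] := exists_maximal snd northA.
rewrite mem_filter => /andP[/and4P[zp zq z1 z2] zA] maxz.
have [zp1 zp2] := ideal_pos Isp zA.
have ez1 : z.1 = q.1.-1.
  have [le|lt] := leqP q.1 z.1; last by move: z1 lt; clear; lia.
  by move/eqP: zq; case; apply: maxq.
have lt_zp : z.2 < p.2.
  rewrite ltnNge; apply/negP => le; move/eqP: zp; case; apply: maxp => //.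
  by rewrite ez1; move: lt_pq; clear; lia.
have maxz' (b : box) : b \in A -> b != p -> b != q ->
    z.1 <= b.1 -> z.2 <= b.2 -> b = z.
  move=> bA bp bq l1 l2.
  have bF : b \in filter Pz A.
    by rewrite mem_filter bA andbT /Pz bp bq -ez1 l1 (leq_trans z2 l2).
  have le2 := maxz _ bF.
  have [le|lt] := leqP q.1 b.1.
    by move/eqP: bq; case; apply: maxq => //; apply: leq_trans l2.
  rewrite [b]surjective_pairing [z]surjective_pairing; congr (_, _).
    by move: ez1 l1 lt; clear; lia.
  by move: le2 l2; clear; lia.
pose u := filter (fun b : box => b \notin [:: p; q; z]) A.
have inu (b : box) : (b \in u) = (b \notin [:: p; q; z]) && (b \in A) by rewrite mem_filter.
have removed (b x : box) : b \in A -> b \notin [:: p; q; z] -> x.1 <= b.1 -> x.2 <= b.2 ->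
    x \notin [:: p; q; z].
  move=> bA; rewrite !inE !negb_or => /and3P[bp bq bz] l1 l2; apply/and3P; split.
  - by apply: contra bp => /eqP e; apply/eqP; apply: maxp => //; rewrite -e.
  - by apply: contra bq => /eqP e; apply/eqP; apply: maxq => //; rewrite -e.
  - by apply: contra bz => /eqP e; apply/eqP; apply: maxz' => //; rewrite -e.
have cu : chain [::] u.
  have := @chain_filter (fun b : box => b \notin [:: p; q; z]) [::] A csp; apply.
  move=> b; rewrite cats0 => bA bN.
  by split=> _; apply: (removed b) => //=; rewrite leq_pred.
have Iu := chain_total_ideal cu.
have zNu : z \notin u by rewrite inu !inE eqxx !orbT.
have pNu : p \notin u by rewrite inu !inE eqxx.
have qNu : q \notin u by rewrite inu !inE eqxx !orbT.
have e1 : [:: p, z & u] =i t.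
  move=> b; rewrite !inE inu !inE; have := inA' b.
  have [->|_] := eqVneq b p; first by rewrite pt.
  have [->|bz] := eqVneq b z; first by rewrite zA (negPf zq).
  have [->|_] /= := eqVneq b q; first by rewrite (negPf qt).
  by move=> ->.
have e2 : [:: q, z & u] =i s.
  move=> b; rewrite !inE inu !inE; have := inA b.
  have [->|_] := eqVneq b q; first by rewrite qs.
  have [->|bz] := eqVneq b z; first by rewrite zA (negPf zp).
  have [->|_] /= := eqVneq b p; first by rewrite (negPf ps).
  by move=> ->.
have Iz : ideal (z :: u).
  apply/allP => b bzu.
  have b2 : supported [:: p, z & u] b.
    by apply: (allP (_ : ideal _)); [rewrite (eq_ideal e1)|rewrite inE bzu orbT].
  have b3 : supported [:: q, z & u] b.
    by apply: (allP (_ : ideal _)); [rewrite (eq_ideal e2)|rewrite inE bzu orbT].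
  move: b2 b3; rewrite /supported !inE.
  case/and4P=> -> -> n1 w1 /and4P[_ _ n2 w2] /=; apply/andP; split.
    case/or4P: n1 n2 => [->//|/eqP->|->|->]; rewrite ?orbT //.
    by rewrite (negPf npq) => /or4P[->//|//|->|->]; rewrite ?orbT.
  case/or4P: w1 w2 => [->//|/eqP->|->|->]; rewrite ?orbT //.
  by rewrite (negPf npq) => /or4P[->//|//|->|->]; rewrite ?orbT.
have Iall : ideal [:: q, p, z & u].
  rewrite (@eq_ideal _ A) // => b; rewrite inA' inE; congr (_ || _); exact: e1.
exists u, z; split.
- rewrite chain_cat cats0 cu /= Iu zNu Iz Iall andbT !inE !negb_or.
  rewrite (eq_ideal e1) It pNu qNu /= !andbT.
  by rewrite eq_sym zp eq_sym npq eq_sym zq.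
- rewrite chain_cat cats0 cu /= Iu zNu Iz (eq_ideal e2) Is andbT !inE !negb_or.
  rewrite pNu qNu npq eq_sym zq eq_sym zp /=.
  rewrite (@eq_ideal _ [:: q, p, z & u]) // => b; rewrite !inE orbCA //.
- apply: uniq_perm => //.
    rewrite cat_uniq (proj1 (chain_uniq cu)) /= !inE !negb_or.
    rewrite (negPf zNu) (negPf pNu) (negPf qNu).
    by rewrite zp zq eq_sym npq.
  move=> b; rewrite mem_cat inu !inE.
  have [->|_] := eqVneq b z; first by rewrite zA !orbT.
  have [->|_] := eqVneq b q; first by rewrite qA !orbT.
  have [->|_] /= := eqVneq b p; first by rewrite pA.
  by rewrite orbF.
- by move: ez1 lt_pq lt_zp z2 q1; rewrite /between /content; clear; lia.
Qed.

(** By induction on the size.  Tableaux with the largest entry in the same box are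
    linked after deletion of that entry; otherwise [corner_bridge] provides two
    linked tableaux, one with its largest entry in each of the two boxes. *)
Lemma dual_connected (P : seq box -> Prop) :
  (forall s i, chain [::] s -> i + 3 <= size s -> P s -> P (act_at i dual s)) ->
  forall s t, chain [::] s -> chain [::] t -> perm_eq s t -> P s -> P t.
Proof.
move=> HP s; have [n] := ubnP (size s); elim: n P HP s => // n IHn P HP s.
have step w w' p : size w < n -> chain [::] (rcons w p) ->
    chain [::] (rcons w' p) -> perm_eq w w' -> P (rcons w p) -> P (rcons w' p).
  move=> lt_w c1 c2 pw Pw.
  (* The induction hypothesis moves the first boxes while [p] stays last. *)
  pose P' v := chain [::] (rcons v p) /\ P (rcons v p).
  have [c3 _ _] := chain_rcons c1; have [c4 _ _] := chain_rcons c2.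
  suff [] : P' w' by [].
  apply: (IHn P' _ w) => // v i cv le_i [cvp Pvp]; rewrite /P' -act_dual_rcons //.
  split; first exact: chain_act_dual.
  by apply: HP => //; rewrite size_rcons; lia.
case/lastP: s => [|s p] le_n t; first by case: t => [|? ?] _ _ /perm_size.
case/lastP: t => [|t q] cs ct st Ps; first by have := perm_size st; rewrite size_rcons.
rewrite size_rcons in le_n.
have [e|npq] := eqVneq p q.
  rewrite -{q}e in ct st *; apply: (step s) => //.
  by move: st; rewrite -!cats1 perm_cat2r.
have [u [z [c1 c2 pe B]]] := corner_bridge cs ct st npq.
have es : size s = (size u).+2.
  by have := perm_size pe; rewrite size_cat size_rcons addn3 => -[<-].
have e1 : u ++ [:: z; q; p] = rcons (u ++ [:: z; q]) p by rewrite -cats1 -catA.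
have e2 : u ++ [:: z; p; q] = rcons (u ++ [:: z; p]) q by rewrite -cats1 -catA.
have Pu : P (rcons (u ++ [:: z; q]) p).
  apply: (step s); rewrite -?e1 //.
  by rewrite perm_sym; move: pe; rewrite e1 -!cats1 perm_cat2r.
have {}Pu : P (rcons (u ++ [:: z; p]) q).
  rewrite -e2; have := HP _ (size u) c2 _; rewrite e1 size_rcons size_cat /= => /(_ _ Pu).
  rewrite -e1 /act_at take_size_cat // drop_size_cat // dual_cons.
  rewrite ifT; last by rewrite betweenC.
  by apply; lia.
apply: (step (u ++ [:: z; p])) Pu; rewrite -?e2 //; first by rewrite size_cat /=; lia.
have : perm_eq (u ++ [:: z; p; q]) (rcons t q).
  apply: perm_trans st; apply: perm_trans pe; rewrite perm_cat2l perm_cons.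
  by rewrite -[[:: p; q]]/([:: p] ++ [:: q]) perm_catC.
by rewrite e2 -!cats1 perm_cat2r.
Qed.

(** * The half turn of a rectangle *)
Lemma rcons_chain s p : chain [::] s -> p \notin s -> supported s p ->
  chain [::] (rcons s p).
Proof.
move=> cs ps sp; rewrite -cats1 chain_cat cs cats0 /= (chain_total_ideal cs) ps andbT /=.
have sub b : supported s b -> supported (p :: s) b.
  by rewrite /supported !inE; case/and4P=> -> -> /orP[->|->] /orP[->|->]; rewrite ?orbT.
rewrite /ideal /= sub //=; apply/allP => b bs.
by apply: sub; apply: (allP (chain_total_ideal cs)).
Qed.

Definition precedes (s : seq box) (b d : box) := index b s < index d s.

(** The form in which tableaux usually come: entries grow along rows and
    columns. *)
Lemma chainP s : uniq s ->
  reflect (forall b : box, b \in s -> [/\ 0 < b.1, 0 < b.2,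
      1 < b.1 -> precedes s (north b) b & 1 < b.2 -> precedes s (west b) b])
    (chain [::] s).
Proof.
rewrite /precedes; elim/last_ind: s => [|s p IHs]; first by move=> _; apply: (iffP idP).
rewrite rcons_uniq => /andP[ps Us]; have {}IHs := IHs Us.
have indexl (b : box) : b \in s -> index b (rcons s p) = index b s.
  by move=> bs; rewrite -cats1 index_cat bs.
have indexp : index p (rcons s p) = size s.
  by rewrite -cats1 index_cat (negPf ps) /= eqxx addn0.
have indexr (b d : box) : d \in s ->
    (index b (rcons s p) < index d (rcons s p)) = (index b s < index d s).
  move=> ds; rewrite (indexl d) //; case bs : (b \in s); first by rewrite indexl.
  have lt_d : index d s <= size s by apply: index_size.
  rewrite -cats1 index_cat bs.
  rewrite ltnNge (leq_trans lt_d (leq_addr _ _)) /=.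
  by symmetry; rewrite (memNindex (negbT bs)) ltnNge lt_d.
have indexs b : (index b (rcons s p) < size s) = (b \in s).
  rewrite -cats1 index_cat; case: ifP => bs; first by rewrite index_mem.
  by rewrite ltnNge leq_addr.
apply: (iffP idP) => [csp b|H].
  have [/IHs Hs _ _] := chain_rcons csp.
  rewrite mem_rcons inE => /orP[/eqP->|bs]; last first.
    by rewrite !indexr //; apply: Hs.
  have /and4P[p1 p2 n w] : supported (p :: s) p.
    move: csp; rewrite -cats1 chain_cat cats0 => /andP[_ /chain_behead/chain_ideal].
    by case/andP.
  split=> // [lt1|lt1].
    rewrite indexp indexs; move: n; rewrite inE.
    rewrite (_ : (p.1 == 1) = false) /=; last by apply/eqP => e; rewrite e in lt1.
    case/orP=> // /eqP e; exfalso; move: (congr1 fst e) p1 => /=; clear; lia.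
  rewrite indexp indexs; move: w; rewrite inE.
  rewrite (_ : (p.2 == 1) = false) /=; last by apply/eqP => e; rewrite e in lt1.
  case/orP=> // /eqP e; exfalso; move: (congr1 snd e) p2 => /=; clear; lia.
apply: rcons_chain => //.
  apply/IHs => b bs; have := H b; rewrite mem_rcons inE bs orbT => /(_ isT).
  by rewrite !indexr.
have := H p; rewrite mem_rcons mem_head => /(_ isT); rewrite indexp !indexs.
case=> p1 p2 Hn Hw; rewrite /supported p1 p2 /=.
apply/andP; split; [move: p1 Hn|move: p2 Hw]; clear.
  by case: (p.1) => [|[|n]] // _ ->; rewrite ?orbT.
by case: (p.2) => [|[|n]] // _ ->; rewrite ?orbT.
Qed.

Definition rotate (a c : nat) (b : box) : box := (a.+1 - b.1, c.+1 - b.2).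

Definition rotate_chain (a c : nat) (s : seq box) : seq box :=
  rev (map (rotate a c) s).

Lemma rotateK a c (b : box) : in_rectangle a c b -> rotate a c (rotate a c b) = b.
Proof.
case: b => i j; rewrite /in_rectangle /rotate /= => H.
by congr (_, _); move: H; lia.
Qed.

Lemma in_rectangle_rotate a c (b : box) :
  in_rectangle a c b -> in_rectangle a c (rotate a c b).
Proof. by case: b => i j; rewrite /in_rectangle /rotate /=; lia. Qed.

Lemma rotate_chainK a c s : {subset s <= in_rectangle a c} ->
  rotate_chain a c (rotate_chain a c s) = s.
Proof.
move=> H; rewrite /rotate_chain map_rev revK -map_comp.
by apply: map_id_in => b /H /rotateK.
Qed.

Lemma rotate_chain_cat a c s t :
  rotate_chain a c (s ++ t) = rotate_chain a c t ++ rotate_chain a c s.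
Proof. by rewrite /rotate_chain map_cat rev_cat. Qed.

Lemma size_rotate_chain a c s : size (rotate_chain a c s) = size s.
Proof. by rewrite size_rev size_map. Qed.

Lemma content_rotate a c (b : box) : in_rectangle a c b ->
  content (rotate a c b) = (c%:Z - a%:Z - content b)%R.
Proof.
by case: b => i j; rewrite /in_rectangle /content /rotate /= => H; lia.
Qed.

Lemma rotate_dual a c x y z : all (in_rectangle a c) [:: x; y; z] ->
  rotate_chain a c (dual [:: x; y; z]) = dual (rotate_chain a c [:: x; y; z]).
Proof.
case/and4P=> /content_rotate rx /content_rotate ry /content_rotate rz _.
rewrite /rotate_chain !dual_cons /between rx ry rz.
by do 2![case: ifP => ?]; do 2?[case: ifP => ?] => //; exfalso; lia.
Qed.

Lemma split_at i (s : seq box) n : i + n <= size s ->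
  exists w t v, [/\ s = w ++ t ++ v, size w = i & size t = n].
Proof.
move=> le_n; exists (take i s), (take n (drop i s)), (drop n (drop i s)).
by split; rewrite ?cat_take_drop // size_takel ?size_drop //; lia.
Qed.

Lemma act_at_cat f w t : act_at (size w) f (w ++ t) = w ++ f t.
Proof. by rewrite /act_at take_size_cat // drop_size_cat. Qed.

(** The half turn reverses the order of the diagonals, and betweenness is
    symmetric. *)
Lemma rotate_act_dual a c s i : {subset s <= in_rectangle a c} -> i + 3 <= size s ->
  rotate_chain a c (act_at i dual s) =
  act_at (size s - 3 - i) dual (rotate_chain a c s).
Proof.
move=> sR /split_at[w [t [v [es ew et]]]]; rewrite es in sR *.
rewrite -{1}ew act_at_cat dual_cat ?et // !rotate_chain_cat -!catA.
have -> : size (w ++ t ++ v) - 3 - i = size (rotate_chain a c v).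
  by rewrite !size_cat et ew size_rotate_chain; lia.
rewrite act_at_cat dual_cat ?size_rotate_chain ?et //; congr (_ ++ (_ ++ _)).
case: t et sR {es} => [|x [|y [|z [|]]]] // _ sR; apply: rotate_dual.
by apply/allP => b bt; apply: sR; rewrite !mem_cat bt orbT.
Qed.

Lemma rotate_descent a c s i : {subset s <= in_rectangle a c} -> i + 2 <= size s ->
  descent (drop (size s - 2 - i) (rotate_chain a c s)) = descent (drop i s).
Proof.
move=> sR /split_at[w [t [v [es ew et]]]]; rewrite es in sR *.
have -> : size (w ++ t ++ v) - 2 - i = size (rotate_chain a c v).
  by rewrite !size_cat et ew size_rotate_chain; lia.
rewrite !rotate_chain_cat -!catA drop_size_cat // -ew drop_size_cat //.
case: t et sR {es} => [|x [|y [|]]] // _ sR.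
have [xR yR] : in_rectangle a c x /\ in_rectangle a c y.
  by split; apply: sR; rewrite !mem_cat !inE eqxx !orbT.
by rewrite /= (content_rotate xR) (content_rotate yR); lia.
Qed.

Lemma index_cat_rotate_chain a c s t (b : box) :
  uniq (s ++ rotate_chain a c t) -> b \in t ->
  index (rotate a c b) (s ++ rotate_chain a c t) =
    size s + (size t - (index b t).+1).
Proof.
move=> Ug bt; have lt_b : index b t < size t by rewrite index_mem.
have e : nth (0, 0) (s ++ rotate_chain a c t)
    (size s + (size t - (index b t).+1)) = rotate a c b.
  rewrite nth_cat ifN; last by rewrite -leqNgt leq_addr.
  rewrite addKn nth_rev size_map; last first.
    by rewrite ltn_subrL (leq_ltn_trans _ lt_b).
  rewrite subnSK // subKn; last exact: ltnW.
  by rewrite (nth_map (0, 0)) // nth_index.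
rewrite -{1}e index_uniq // size_cat size_rotate_chain ltn_add2l.
by rewrite ltn_subrL (leq_ltn_trans _ lt_b).
Qed.

(** For a box of the second part, north and south are exchanged by the half turn
    and earlier and later by the reversal. A north neighbour that is not the half
    turn of a box of [t] belongs to [s], hence comes earlier too. *)
Lemma chain_glue a c s t : chain [::] s -> chain [::] t ->
  uniq (s ++ rotate_chain a c t) ->
  fills_rectangle a c (s ++ rotate_chain a c t) ->
  chain [::] (s ++ rotate_chain a c t).
Proof.
move=> cs ct Ug fR; apply/(chainP Ug).
have [Us _] := chain_uniq cs; have [Ut _] := chain_uniq ct.
have Hs := elimT (chainP Us) cs; have Ht := elimT (chainP Ut) ct.
have tR (b : box) : b \in t -> in_rectangle a c b.
  move=> bt; have [b1 b2 _ _] := Ht b bt.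
  have : in_rectangle a c (rotate a c b).
    by rewrite fR mem_cat mem_rev map_f ?orbT.
  by move: b1 b2; rewrite /in_rectangle /=; clear; lia.
have index_rot b bt := index_cat_rotate_chain Ug (b := b) bt.
have rot_t (b : box) : b \in rotate_chain a c t ->
    exists2 d : box, d \in t & b = rotate a c d.
  by rewrite mem_rev => /mapP.
have later (d e : box) : d \in t -> in_rectangle a c e -> (e \in t -> precedes t d e) ->
    precedes (s ++ rotate_chain a c t) (rotate a c e) (rotate a c d).
  move=> dt eR et; rewrite /precedes (index_rot d) //.
  have := fR (rotate a c e); rewrite in_rectangle_rotate // mem_cat => /esym/orP[es|].
    by rewrite index_cat es ltn_addr // index_mem.
  case/rot_t => e' e't /(congr1 (rotate a c)).
  rewrite (rotateK eR) (rotateK (tR _ e't)) => ee.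
  rewrite {e eR}ee in et *; rewrite index_rot // ltn_add2l; have := et e't.
  have lt_e' : index e' t < size t by rewrite index_mem.
  by rewrite /precedes => lt_de; apply: ltn_sub2l; rewrite // (leq_ltn_trans lt_de).
move=> b; rewrite mem_cat => /orP[bs|/rot_t[d dt ->]].
  have catl (d : box) : precedes s d b -> precedes (s ++ rotate_chain a c t) d b.
    rewrite /precedes !index_cat bs => lt_d; rewrite ifT //.
    by rewrite -index_mem (ltn_trans lt_d) ?index_mem.
  have [b1 b2 Hn Hw] := Hs b bs; split=> // [/Hn|/Hw]; exact: catl.
have := tR d dt; rewrite /in_rectangle => dR; have [d1 d2 _ _] := Ht d dt.
split=> [||lt|lt] /=; try by move: dR; clear; lia.
  have -> : north (rotate a c d) = rotate a c (d.1.+1, d.2).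
    by rewrite /north /rotate /=; congr (_, _); clear; lia.
  apply: later => //; first by move: dR lt; rewrite /in_rectangle /=; clear; lia.
  by case/Ht=> _ _ /(_ d1); rewrite /north /= -surjective_pairing.
have -> : west (rotate a c d) = rotate a c (d.1, d.2.+1).
  by rewrite /west /rotate /=; congr (_, _); clear; lia.
apply: later => //; first by move: dR lt; rewrite /in_rectangle /=; clear; lia.
by case/Ht=> _ _ _ /(_ d2); rewrite /west /= -surjective_pairing.
Qed.

(** * The tableau filled row after row *)
Definition row_box (c i : nat) : box := ((i %/ c).+1, (i %% c).+1).

Definition row_superstandard (a c : nat) : seq box := mkseq (row_box c) (a * c).

Definition rank (c : nat) (b : box) : nat := b.1.-1 * c + b.2.-1.

Lemma rankK a c (b : box) : in_rectangle a c b -> row_box c (rank c b) = b.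
Proof.
case: b => i j; rewrite /in_rectangle /row_box /rank /=.
move=> /andP[/andP[i0 _] /andP[j0 jc]].
have c0 : 0 < c by apply: leq_trans jc.
have lt_j : j.-1 < c by rewrite prednK.
by rewrite divnMDl // divn_small // addn0 modnMDl modn_small // !prednK.
Qed.

Lemma row_boxK c i : 0 < c -> rank c (row_box c i) = i.
Proof. by move=> c0; rewrite /rank /= -divn_eq. Qed.

Lemma row_box_inj c : 0 < c -> injective (row_box c).
Proof. by move=> c0; apply: can_inj (rank c) _ => i; apply: row_boxK. Qed.

Lemma in_rectangle_row_box a c i : 0 < c -> i < a * c -> in_rectangle a c (row_box c i).
Proof. by move=> c0 lt_i; rewrite /in_rectangle /= ltn_divLR // lt_i ltn_pmod. Qed.

Lemma rank_lt a c (b : box) : in_rectangle a c b -> rank c b < a * c.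
Proof.
case: b => i j; rewrite /in_rectangle /rank /= => /andP[/andP[i0 ia] /andP[j0 jc]].
apply: (@leq_trans (i * c)); last by rewrite leq_mul2r ia orbT.
by rewrite -{2}(prednK i0) mulSn addnC ltn_add2r prednK.
Qed.

Lemma mem_row_superstandard a c : 0 < c -> fills_rectangle a c (row_superstandard a c).
Proof.
move=> c0 b; apply/idP/mapP => [bR|[i]].
  by exists (rank c b); rewrite ?(rankK bR) // mem_iota rank_lt.
by rewrite mem_iota => /andP[_ lt_i] ->; apply: in_rectangle_row_box.
Qed.

Lemma row_superstandard_chain a c : 0 < c -> chain [::] (row_superstandard a c).
Proof.
move=> c0; rewrite /row_superstandard; elim: (a * c) => // n IHn.
rewrite -addn1 /mkseq iotaD map_cat cats1; apply: rcons_chain => //=.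
  apply/mapP => -[i]; rewrite mem_iota => /andP[_ lt_i] /row_box_inj e.
  by rewrite e // ltnn in lt_i.
have before i : i < n -> row_box c i \in map (row_box c) (iota 0 n).
  by move=> lt_i; apply: map_f; rewrite mem_iota.
rewrite /supported /=; apply/andP; split.
  have [e|n0] := posnP (n %/ c); first by rewrite e.
  apply/orP; right.
  have le_c : c <= n by rewrite -divn_gt0.
  have -> : north (row_box c n) = row_box c (n - c).
    have e : n = c + (n - c) by rewrite subnKC.
    rewrite /north /row_box /= {1 2}e divnDl ?dvdnn // divnn c0 add1n /=.
    by rewrite modnDl.
  by apply: before; rewrite ltn_subrL c0 (leq_trans c0 le_c).
have [e|n0] := posnP (n %% c); first by rewrite e.
apply/orP; right.
have lt0n : 0 < n by rewrite lt0n; apply: contraTneq n0 => ->; rewrite mod0n.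
have -> : west (row_box c n) = row_box c n.-1.
  have lt_m := ltn_pmod n c0.
  rewrite /west /row_box /=.
  have -> : n.-1 = n %/ c * c + (n %% c).-1.
    by rewrite {1}(divn_eq n c); case: (n %% c) n0 => // m _; rewrite addnS.
  have lt_m' := leq_ltn_trans (leq_pred _) lt_m.
  by rewrite divnMDl // modnMDl (divn_small lt_m') (modn_small lt_m') addn0 prednK.
by apply: before; rewrite prednK.
Qed.

Definition descends_at_row_ends (c : nat) (s : seq box) : Prop :=
  forall i, i + 2 <= size s -> descent (drop i s) -> c %| i.+1.

Lemma row_superstandard_descends a c : 0 < c ->
  descends_at_row_ends c (row_superstandard a c).
Proof.
move=> c0 i; rewrite size_mkseq => le_i; rewrite /row_superstandard.
have -> : mkseq (row_box c) (a * c) =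
    mkseq (row_box c) i ++ [:: row_box c i, row_box c i.+1 &
      map (row_box c) (iota i.+2 (a * c - i.+2))].
  by rewrite /mkseq -{1}(subnKC le_i) !iotaD !map_cat -catA /= add0n !addn2.
rewrite drop_size_cat ?size_mkseq // /= /content /= => lt.
have [//|Ni] := boolP (c %| i.+1).
move: lt; rewrite divnS // (negPf Ni) add0n modnS (negPf Ni); clear; lia.
Qed.

Lemma size_fills a c s : 0 < c -> uniq s -> fills_rectangle a c s -> size s = a * c.
Proof.
move=> c0 Us fR; rewrite -(size_mkseq (row_box c) (a * c)).
apply/perm_size/uniq_perm => //.
  by rewrite map_inj_uniq ?iota_uniq //; apply: row_box_inj.
by move=> b; rewrite -fR -mem_row_superstandard.
Qed.

(** If the first i boxes are those of the row by row tableau, the next box either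
    continues the current row or opens the next one.  Opening a row before the
    current one is full would be a descent at a place that is not the end of a
    row. *)
Lemma row_superstandard_unique a c s : 0 < c -> chain [::] s ->
  fills_rectangle a c s -> descends_at_row_ends c s -> s = row_superstandard a c.
Proof.
move=> c0 cs fR Hd; have [Us _] := chain_uniq cs.
have es := size_fills c0 Us fR.
have Hc := elimT (chainP Us) cs.
apply: (@eq_from_nth _ (0, 0)) => [|i]; first by rewrite size_mkseq.
rewrite es => lt_i; rewrite nth_mkseq //.
have [n] := ubnP i; elim: n i lt_i => // n IHn i lt_i; rewrite ltnS => le_i.
have {n IHn le_i} IH j : j < i -> nth (0, 0) s j = row_box c j.
  by move=> lt_j; apply: IHn; [apply: ltn_trans lt_i|apply: leq_trans le_i].
set b := nth (0, 0) s i.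
have lt_is : i < size s by rewrite es.
have bs : b \in s by apply: mem_nth.
have ib : index b s = i by apply: index_uniq.
have bR : in_rectangle a c b by rewrite fR.
have early (d : box) : index d s < i -> rank c d = index d s.
  move=> lt_d; have ds : d \in s by rewrite -index_mem (ltn_trans lt_d).
  by rewrite -[in LHS](nth_index (0, 0) ds) IH // row_boxK.
have ge_b : i <= rank c b.
  rewrite leqNgt; apply/negP => lt_b; have := IH _ lt_b.
  rewrite (rankK bR) /b => /eqP; rewrite nth_uniq ?(ltn_trans lt_b) // => /eqP e.
  by rewrite e ltnn in lt_b.
suff e : rank c b = i by rewrite -e (rankK bR).
have [b1 b2 Hn Hw] := Hc b bs; rewrite /precedes ib in Hn Hw.
have [j1|j1] := ltnP 1 b.2.
  have := early _ (Hw j1); have := Hw j1; rewrite /rank /west /= => lt_w ew.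
  by move: lt_w ew ge_b j1; rewrite /rank; clear; lia.
have ej : b.2 = 1 by move: b2 j1; clear; lia.
have [i1|i1] := ltnP 1 b.1; last first.
  have ei : b.1 = 1 by move: b1 i1; clear; lia.
  by move: ge_b; rewrite /rank ei ej /= mul0n; case: (i).
have := early _ (Hn i1); have := Hn i1; rewrite /rank /north /= ej /= addn0 => lt_n en.
move: ge_b; rewrite /rank ej /= addn0 leq_eqVlt => /orP[/eqP->//|lt_b].
have i0 : 0 < i by apply: leq_ltn_trans lt_n.
(* Here [b] opens row r + 2 while row r + 1 is still incomplete. *)
set r := b.1.-2; have er : b.1 = r.+2 by rewrite /r; move: i1; clear; lia.
rewrite er /= in lt_n en lt_b.
have ri : r * c < i by rewrite en.
have Ndvd : ~~ (c %| i.-1.+1).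
  rewrite prednK //; apply/negP => /dvdnP[q eq_i].
  move: ri lt_b; rewrite eq_i !ltn_pmul2r //; clear; lia.
have edrop : drop i.-1 s = [:: row_box c i.-1, b & drop i.+1 s].
  rewrite (drop_nth (0, 0)) ?(leq_ltn_trans (leq_pred i)) // IH ?prednK //.
  by rewrite (drop_nth (0, 0)).
have := Hd i.-1; rewrite edrop => /(_ _ _)/negPf; rewrite /= (negPf Ndvd).
have q : i.-1 %/ c = r.
  apply/eqP; rewrite eqn_leq -ltnS ltn_divLR // leq_divRL //.
  by move: ri lt_b i0; rewrite !mulSn; clear; lia.
move=> H; exfalso; move/negP: Ndvd; apply; apply: (Hd i.-1).
  by rewrite es; move: lt_i i0; clear; lia.
by rewrite edrop /= /content /= er ej q; clear; lia.
Qed.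

(** Evacuation and the half turn both mirror dual equivalences, which act
    transitively, so the claim has to be checked on one tableau only; for the row
    by row tableau it follows from its characterization by descents, since the
    set of row ends is invariant under mirroring. *)
Theorem evacuate_rectangle a c s : 0 < c -> chain [::] s ->
  fills_rectangle a c s -> evacuate s = rotate_chain a c s.
Proof.
move=> c0 cs fR.
have fills_perm t u : perm_eq t u -> fills_rectangle a c t -> fills_rectangle a c u.
  by move=> tu ft b; rewrite ft (perm_mem tu).
have sub t : fills_rectangle a c t -> {subset t <= in_rectangle a c}.
  by move=> ft b bt; rewrite -topredE /= ft.
have rot_perm t : chain [::] t -> fills_rectangle a c t ->
    perm_eq (rotate_chain a c t) t.
  move=> ct ft; have [Ut _] := chain_uniq ct; apply: uniq_perm => //.
    rewrite rev_uniq map_inj_in_uniq // => x y /sub-/(_ ft) xR /sub-/(_ ft) yR e.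
    by rewrite -(rotateK xR) e rotateK.
  move=> b; rewrite mem_rev; apply/mapP/idP => [[d dt ->]|bt].
    by rewrite -ft in_rectangle_rotate // ft.
  by exists (rotate a c b); rewrite ?rotateK -?ft ?in_rectangle_rotate // ft.
pose P t := fills_rectangle a c t /\ evacuate t = rotate_chain a c t.
suff [] : P s by [].
set u := row_superstandard a c.
have cu : chain [::] u := row_superstandard_chain a c0.
have fu : fills_rectangle a c u := mem_row_superstandard a c0.
have [Uu _] := chain_uniq cu; have [Us _] := chain_uniq cs.
have su := size_fills c0 Uu fu.
have du : descends_at_row_ends c u := row_superstandard_descends c0.
have mirror i : i + 2 <= size u -> c %| (size u - 2 - i).+1 -> c %| i.+1.
  rewrite su => le_i; have -> : (a * c - 2 - i).+1 = a * c - i.+1 by lia.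
  by rewrite dvdn_subr ?dvdn_mull //; lia.
apply: (@dual_connected P _ u s cu cs).
- move=> t i ct le_i [ft et]; split.
    by apply: (fills_perm _ _ _ ft); rewrite perm_sym perm_act_dual.
  rewrite rotate_act_dual //; last exact: sub.
  by rewrite -et (@evacuate_act_dual a c [::]) ?cats0.
- by apply: uniq_perm => // b; rewrite -fu fR.
- split=> //; transitivity u.
    apply: row_superstandard_unique => //; first exact: chain_evacuate.
      by apply: (fills_perm _ _ _ fu); rewrite perm_sym perm_evacuate.
    move=> i; rewrite size_evacuate => le_i.
    have le_i' : (size u - 2 - i) + 2 <= size u by lia.
    have := @evacuate_descent a c [::] u _ _ cu le_i'; rewrite cats0 => /(_ fu).
    rewrite (_ : size u - 2 - (size u - 2 - i) = i); last by lia.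
    by move=> -> /(du _ le_i'); apply: mirror.
  symmetry; apply: row_superstandard_unique => //.
  - have := @chain_glue a c [::] u isT cu; rewrite !cat0s; apply.
      by rewrite (perm_uniq (rot_perm u cu fu)).
    by apply: (fills_perm _ _ _ fu); rewrite perm_sym rot_perm.
  - by apply: (fills_perm _ _ _ fu); rewrite perm_sym rot_perm.
  move=> i; rewrite size_rotate_chain => le_i.
  have le_i' : (size u - 2 - i) + 2 <= size u by lia.
  have := @rotate_descent a c u _ (sub u fu) le_i'.
  rewrite (_ : size u - 2 - (size u - 2 - i) = i); last by lia.
  by move=> -> /(du _ le_i'); apply: mirror.
Qed.

(** * Fillings and lists of boxes *)

Local Open Scope fset_scope.
Local Open Scope fmap_scope.

(** The shift [k] leaves room for the labels 1, ..., k that an evacuation in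
    progress has already placed. *)
Definition fill (k : nat) (s : seq box) : filling :=
  [fmap b : seq_fset tt s => (k + index (val b) s).+1].

Lemma mem_fill k s (b : box) : (b \in domf (fill k s)) = (b \in s).
Proof. exact: seq_fsetE. Qed.

Lemma fnd_fill k s (b : box) :
  (fill k s).[? b] = if b \in s then Some (k + index b s).+1 else None.
Proof.
case: ifP => [bs|/negbT nbs]; last by apply: not_fnd; rewrite mem_fill.
have bF : b \in domf (fill k s) by rewrite mem_fill.
by rewrite (in_fnd bF) ffunE.
Qed.

Lemma entry_fill k s (b : box) : b \in s -> entry (fill k s) b = (k + index b s).+1.
Proof. by move=> bs; rewrite /entry fnd_fill bs. Qed.

(** Read from the end: if the last two boxes are adjacent the empty box moves to
    the earlier one, otherwise the earlier one is passed over. *)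
Lemma slide_rcons_rcons w x h : slide (rcons (rcons w x) h) =
  if neighbour_diagonals x h then rcons (slide (rcons w x)) h
  else rcons (slide (rcons w h)) x.
Proof.
elim: w => [|y w IHw]; first by rewrite /= ; case: ifP.
rewrite !rcons_cons -[slide (y :: _)]/(toggle (y :: slide _)) IHw.
have slide_y u z : slide (y :: rcons u z) = toggle (y :: slide (rcons u z)) by [].
have toggle_rcons v z : v != [::] -> toggle (y :: rcons v z) = rcons (toggle (y :: v)) z.
  by case: v => // b v _; rewrite rcons_cons !toggle_cons; case: ifP.
have slide_rcons_nonempty u z : slide (rcons u z) != [::].
  by rewrite -size_eq0 size_slide size_rcons.
by case: ifP => A; rewrite toggle_rcons.
Qed.

Lemma chain_middle D pre h post : chain D (pre ++ h :: post) ->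
  [/\ 0 < h.1, 0 < h.2, h \notin pre, h \notin post &
   (forall b : box, b \in pre -> b \notin post) /\
   (north h \notin post /\ west h \notin post)].
Proof.
move=> cs; have [Us HD] := chain_uniq cs.
move: cs; rewrite chain_cat => /andP[_ ch].
have ch2 := chain_behead ch; have Ih := chain_ideal ch2.
have [h1 h2] := ideal_pos Ih (mem_head _ _).
have /and4P[_ _ nh wh] := allP Ih _ (mem_head _ _).
have [_ Hpost] := chain_uniq ch2.
have IG : ideal (rev post ++ h :: pre ++ D).
  move: ch2; rewrite -{1}[post]cats0 chain_cat => /andP[_ /chain_ideal].
  by apply: etrans; apply: eq_ideal => b; rewrite !mem_cat mem_rev.
move: Us; rewrite cat_uniq /= negb_or => /and4P[_ /andP[hpre /hasPn post_pre] hpost _].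
split=> //; split.
  by move=> b bpre; apply/negP => /post_pre; rewrite /= bpre.
split; apply/negP => bpost.
  have [n1 _] : 0 < (north h).1 /\ 0 < (north h).2.
    by apply: (ideal_pos IG); rewrite mem_cat mem_rev bpost.
  move: nh; rewrite (negPf (Hpost _ bpost)) orbF => /eqP e.
  by move: n1; rewrite /= e.
have [_ n1] : 0 < (west h).1 /\ 0 < (west h).2.
  by apply: (ideal_pos IG); rewrite mem_cat mem_rev bpost.
move: wh; rewrite (negPf (Hpost _ bpost)) orbF => /eqP e.
by move: n1; rewrite /= e.
Qed.

(** All boxes of [w] carry smaller entries than [x], so [x] wins against the other
    neighbour of the empty box whenever that one is still present. *)
Lemma next_box_fill k w x post h :
  x \notin w -> x = north h \/ x = west h -> x != h ->
  0 < h.1 -> 0 < h.2 ->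
  north h \notin post -> west h \notin post ->
  next_box (fill k (rcons w x ++ post)) h = Some x.
Proof.
move=> xw ex xh h1 h2 np wp.
have before (b : box) : b \notin post -> b != x ->
    (fill k (rcons w x ++ post)).[? b] =
    if b \in w then Some (k + index b w).+1 else None.
  move=> bp bx; rewrite fnd_fill mem_cat mem_rcons inE (negPf bx) (negPf bp) orbF /=.
  by case: ifP => // bw; rewrite cat_rcons index_cat bw.
have atx : (fill k (rcons w x ++ post)).[? x] = Some (k + size w).+1.
  rewrite fnd_fill mem_cat mem_rcons mem_head /= cat_rcons index_cat (negPf xw).
  by rewrite /= eqxx addn0.
have nw : north h != west h.
  by apply/eqP => /(congr1 fst) /=; move: h1; clear; lia.
rewrite /next_box; case: ex => ex; rewrite -ex.
  rewrite atx before // ?ex 1?eq_sym //; case: ifP => // ww.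
  by rewrite ltnS ltn_add2l index_mem ww.
rewrite atx before // ?ex //; case: ifP => // ww.
by rewrite ltnS ltn_add2l ltnNge index_size.
Qed.

(** During a slide the boxes other than the empty box [h] are [pre ++ post], in
    the order of their entries, and [h] stands between them in the underlying
    chain.  Passing over a box that is not adjacent to [h] changes neither the
    filling nor the empty box; moving into the last box of [pre] is one step of
    the slide. *)
Lemma slide_from_fill D n pre h post b s' :
  chain D (pre ++ h :: post) -> h.1 + h.2 <= n ->
  slide (rcons pre h) = b :: s' ->
  slide_from n (fill 0 (pre ++ post)) h = (fill 0 (s' ++ post), b).
Proof.
have [m] := ubnP (size pre); elim: m n pre h post b s' => // m IHm n pre h post b s'.
case/lastP: pre => [|w x] le_m cs le_n es.
  case: es => <- <-; case: n le_n => //= n _.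
  have [_ _ _ _ [_ [np wp]]] := chain_middle cs.
  by rewrite /next_box !fnd_fill !(negPf np) (negPf wp).
rewrite size_rcons ltnS in le_m.
move: es cs; rewrite slide_rcons_rcons !cat_rcons => es cs.
have [x1 x2 xw xp _] := chain_middle cs.
move: xp; rewrite inE negb_or => /andP[xh xp].
have cs' : chain D (rcons w x ++ h :: post) by rewrite cat_rcons.
have [h1 h2 hw hp [_ [np wp]]] := chain_middle cs'.
move: cs; rewrite chain_cat => /andP[cw cxh].
case: ifP es => A es.
  have ex := chain_adjacent cxh A.
  case: n le_n => [|n] le_n; first by move: h1 le_n; clear; lia.
  rewrite /= -cat_rcons next_box_fill //.
  rewrite cat_rcons entry_fill; last by rewrite mem_cat mem_head orbT.
  rewrite index_cat (negPf xw) /= eqxx addn0 add0n.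
  have [e es'] : exists2 e, slide (rcons w x) = b :: e & s' = rcons e h.
    have : size (slide (rcons w x)) = (size w).+1 by rewrite size_slide size_rcons.
    by case: (slide (rcons w x)) es => // b0 e; rewrite rcons_cons => -[-> <-] _; exists e.
  move=> ->; rewrite cat_rcons -(IHm n w x (h :: post) b e) //; last first.
  - by case: ex le_n x1 x2 h1 h2 => ->; rewrite /north /west /=; clear; lia.
  - by rewrite chain_cat cw cxh.
  congr (slide_from _ _ _); apply/fmapP => d.
  rewrite fnd_rem1 fnd_set !fnd_fill !mem_cat !inE.
  have [->|dx] := eqVneq d x; first by rewrite (negPf xw) (negPf xh) (negPf xp).
  have [->|dh] := eqVneq d h.
    rewrite /= orbT index_cat; move: hw; rewrite mem_rcons inE negb_or => /andP[_ /negPf->].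
    by rewrite /= eqxx addn0.
  rewrite /=; case: ifP => // _; congr (Some (_ + _).+1).
  rewrite !index_cat /=; case: ifP => // _.
  by rewrite eq_sym (negPf dx) eq_sym (negPf dh).
have ct : chain D (w ++ [:: h, x & post]).
  rewrite chain_cat cw /=; have := chain_toggle cxh.
  by rewrite toggle_cons A.
have [e es' ->] : exists2 e, slide (rcons w h) = b :: e & s' = rcons e x.
  have : size (slide (rcons w h)) = (size w).+1 by rewrite size_slide size_rcons.
  by case: (slide (rcons w h)) es => // b0 e; rewrite rcons_cons => -[-> <-] _; exists e.
by rewrite cat_rcons; apply: (IHm n w h (x :: post)).
Qed.

Lemma largest_box_fill pre h : uniq (rcons pre h) ->
  largest_box (fill 0 (rcons pre h)) = Some h.
Proof.
rewrite rcons_uniq => /andP[hpre _]; set T := fill 0 _.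
have valT (d : domf T) : T d = (index (val d) (rcons pre h)).+1 by rewrite ffunE.
have hT : h \in domf T by rewrite mem_fill mem_rcons mem_head.
have ih : index h (rcons pre h) = size pre.
  by rewrite -cats1 index_cat (negPf hpre) /= eqxx addn0.
have inT (d : domf T) : val d \in rcons pre h.
  by have := valP d; rewrite mem_fill.
have last_max (e : box) : e \in rcons pre h -> size pre <= index e (rcons pre h) ->
    e = h.
  rewrite mem_rcons inE => /orP[/eqP //|epre].
  by rewrite -cats1 index_cat epre leqNgt index_mem epre.
have le_last (e : box) : e \in rcons pre h -> index e (rcons pre h) <= size pre.
  by rewrite -index_mem size_rcons.
rewrite /largest_box; case: pickP => [d /forallP/(_ [` hT])|/(_ [` hT])].
  by rewrite !valT /= ih ltnS => /(last_max _ (inT d)) /= ->.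
by case/forallP => d; rewrite !valT /= ih ltnS; apply: le_last (inT d).
Qed.

Lemma sliding_fill D s b s' : chain D s -> slide s = b :: s' ->
  sliding (fill 0 s) = (fill 0 s', b).
Proof.
case/lastP: s => // pre h cs es; have [Us _] := chain_uniq cs.
rewrite /sliding largest_box_fill //.
have hpre : h \notin pre by move: Us; rewrite rcons_uniq => /andP[].
have -> : (fill 0 (rcons pre h)).[~ h] = fill 0 (pre ++ [::]).
  apply/fmapP => d; rewrite fnd_rem1 !fnd_fill cats0 mem_rcons inE.
  have [->|dh] := eqVneq d h; first by rewrite (negPf hpre).
  by rewrite /=; case dp: (d \in pre); rewrite // -cats1 index_cat dp.
rewrite -[s']cats0; apply: (@slide_from_fill D) => //; by rewrite cats1.
Qed.

Lemma evac_from_fill D k s : chain D s ->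
  evac_from (size s) k (fill 0 s) = fill k (evacuate s).
Proof.
have [n] := ubnP (size s); elim: n D k s => // n IHn D k s le_n cs.
have [->|[b [s' es]]] := slide_nil_cons s.
  by apply/fmapP => d; rewrite fnd_fmap0 fnd_fill.
have size_s : size s = (size s').+1 by rewrite -(size_slide s) es.
have cs' : chain D (b :: s') by rewrite -es; apply: chain_slide.
rewrite size_s /= (sliding_fill cs es) (IHn (b :: D)) //; last exact: chain_behead cs'.
  rewrite (evacuate_slide es); apply/fmapP => d; rewrite fnd_set !fnd_fill inE.
  have [->|db] /= := eqVneq d b; first by rewrite eqxx addn0.
  by rewrite eq_sym (negPf db) addnS addSn.
by rewrite size_s in le_n.
Qed.

Lemma evac_fill s : chain [::] s -> evac (fill 0 s) = fill 0 (evacuate s).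
Proof.
move=> cs; have [Us _] := chain_uniq cs.
rewrite /evac -(evac_from_fill 0 cs); congr (evac_from _ _ _).
by rewrite size_seq_fset undup_id.
Qed.

(** * Staircases and the embedding *)
Lemma mem_diagram la i j : ((i, j) \in diagram la) =
  [&& 0 < i, i <= size la, 0 < j & j <= nth 0 la i.-1].
Proof.
rewrite seq_fsetE; apply/allpairsPdep/idP => [[x [y [xi yi [-> ->]]]]|].
  by move: xi yi; rewrite !mem_iota /= => -> ->.
case: i j => [|i] [|j] //=; rewrite ?andbF // => /andP[i1 j1].
by exists i, j; rewrite !mem_iota.
Qed.

Lemma mem_staircase k i j : ((i, j) \in diagram (staircase k)) =
  [&& 0 < i, 0 < j & i + j <= k.+1].
Proof.
rewrite mem_diagram /staircase size_rev size_iota.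
case: i => [|i] //=; have [le_i|lt_i] := leqP i.+1 k.
  by rewrite nth_rev size_iota // nth_iota; lia.
by rewrite /=; lia.
Qed.

Lemma mem_rectangle k (b : box) :
  (b \in diagram (rectangle k)) = in_rectangle k.+1 k b.
Proof.
case: b => i j; rewrite mem_diagram size_nseq nth_nseq /in_rectangle /=.
by case: ifP => H; move: H; lia.
Qed.

(** The boxes are sorted by their entries, which are 1, 2, and so on. *)
Lemma SYT_chain k S : is_SYT (staircase k) S ->
  exists s, [/\ chain [::] s, s =i diagram (staircase k) & S = fill 0 s].
Proof.
case=> dS pS rowS colS; set s := sort (relpre (entry S) leq) (domf S).
have ms : s =i domf S by move=> b; rewrite mem_sort.
have map_s : [seq entry S b | b <- s] = iota 1 (sumn (staircase k)).
  apply: (sorted_eq leq_trans anti_leq).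
  - by rewrite -sort_map; apply: sort_sorted; apply: leq_total.
  - exact: iota_sorted.
  - by apply: perm_trans pS; apply: perm_map; rewrite perm_sort.
have size_s : size s = sumn (staircase k) by rewrite -(size_map (entry S)) map_s size_iota.
have entry_s (b : box) : b \in s -> entry S b = (index b s).+1.
  move=> bs; have lt_b : index b s < size s by rewrite index_mem.
  have := nth_map b 0 (entry S) lt_b; rewrite map_s nth_index // => <-.
  by rewrite nth_iota -?size_s // add1n.
have Us : uniq s by rewrite sort_uniq fset_uniq.
exists s; split; last first.
- apply/fmapP => b; rewrite fnd_fill ms add0n; case: ifP => bS; last by rewrite not_fnd ?bS.
  by rewrite -entry_s ?ms // /entry (in_fnd bS).
- by move=> b; rewrite ms dS.
apply/(chainP Us) => -[i j] bs; have := bs; rewrite ms dS mem_staircase => /and3P[i0 j0 le].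
split=> //= lt.
  have ns : (i.-1, j) \in s by rewrite ms dS mem_staircase j0; lia.
  rewrite /precedes -ltnS -!entry_s //.
  by have := colS i.-1 j; rewrite prednK // -!ms; apply.
have ns : (i, j.-1) \in s by rewrite ms dS mem_staircase i0; lia.
rewrite /precedes -ltnS -!entry_s //.
by have := rowS i j.-1; rewrite prednK // -!ms; apply.
Qed.

(** A staircase and its half turn tile the rectangle: they are the boxes on the two
    sides of the antidiagonals i + j = k + 1 and i + j = k + 2. *)
Lemma glue_staircases_fills k s t :
  s =i diagram (staircase k) -> t =i diagram (staircase k) ->
  fills_rectangle k.+1 k (s ++ rotate_chain k.+1 k t).
Proof.
move=> ms mt.
case=> i j; rewrite mem_cat ms mem_staircase mem_rev.
have -> : ((i, j) \in [seq rotate k.+1 k b | b <- t]) =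
    in_rectangle k.+1 k (i, j) && (k.+1 < i + j).
  apply/mapP/idP => [[[i' j']]|/andP[R lt]].
    rewrite mt mem_staircase /rotate /in_rectangle /= => H -[-> ->].
    by move: H; lia.
  exists (rotate k.+1 k (i, j)); last by rewrite rotateK.
  by rewrite mt mem_staircase; move: R lt; rewrite /in_rectangle /=; lia.
by rewrite /in_rectangle /=; lia.
Qed.

Lemma glue_staircases_uniq k s t : chain [::] s -> chain [::] t ->
  s =i diagram (staircase k) -> t =i diagram (staircase k) ->
  uniq (s ++ rotate_chain k.+1 k t).
Proof.
move=> cs ct ms mt; have [Us _] := chain_uniq cs; have [Ut _] := chain_uniq ct.
rewrite cat_uniq Us rev_uniq map_inj_in_uniq ?Ut ?andbT /=.
  apply/hasPn => b; rewrite mem_rev => /mapP[[i j]].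
  rewrite mt mem_staircase => H -> /=; rewrite ms /rotate mem_staircase /=.
  by move: H; clear; lia.
move=> [i j] [i' j']; rewrite !mt !mem_staircase /rotate /= => H H' [e1 e2].
by congr (_, _); move: H H' e1 e2; lia.
Qed.

Lemma glue_staircases_chain k s t : chain [::] s -> chain [::] t ->
  s =i diagram (staircase k) -> t =i diagram (staircase k) ->
  chain [::] (s ++ rotate_chain k.+1 k t).
Proof.
move=> cs ct ms mt; apply: chain_glue => //; first exact: glue_staircases_uniq.
exact: glue_staircases_fills.
Qed.

(** The list has k (k + 1) boxes by the tiling of the rectangle, so reading
    backwards from its end turns the i-th box of [evacuate s] into the one with
    entry k (k + 1) + 1 - i. *)
Lemma embed_fill k s : 0 < k -> chain [::] s -> s =i diagram (staircase k) ->
  embed k (fill 0 s) = fill 0 (s ++ rotate_chain k.+1 k (evacuate s)).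
Proof.
move=> k0 cs ms; set t := evacuate s.
have ct : chain [::] t := chain_evacuate cs.
have mt : t =i diagram (staircase k).
  by move=> b; rewrite (perm_mem (perm_evacuate s)).
have Ug := glue_staircases_uniq cs ct ms mt; have fg := glue_staircases_fills ms mt.
have size_g := size_fills k0 Ug fg.
rewrite size_cat size_rotate_chain size_evacuate mulnC in size_g.
apply/fmapP => b; rewrite fnd_fill -fg -mem_rectangle add0n.
case: ifP => bR; last by rewrite not_fnd //= bR.
have bE : b \in domf (embed k (fill 0 s)) by [].
rewrite (in_fnd bE) ffunE /=; congr Some.
rewrite mem_rectangle in bR.
case: b bR {bE} => i j bR; case: ifP => le.
  have bs : (i, j) \in s.
    by rewrite ms mem_staircase; move: bR le; rewrite /in_rectangle /=; lia.
  by rewrite entry_fill // index_cat bs.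
have dt : rotate k.+1 k (i, j) \in t.
  by rewrite mt mem_staircase; move: bR le; rewrite /in_rectangle /=; lia.
rewrite evac_fill // -[(k.+2 - i, _)]/(rotate k.+1 k (i, j)) entry_fill //.
rewrite -[X in index X (_ ++ _)](rotateK bR) index_cat_rotate_chain //.
have : index (rotate k.+1 k (i, j)) t < size t by rewrite index_mem.
rewrite -size_g size_evacuate add0n; move: (index _ _) (size s); clear.
by move=> x y; lia.
Qed.

Theorem theorem3p7 (k : nat) (hk : 2 < k) (S : filling)
    (hS : is_SYT (staircase k) S) :
  embed k (evac S) = evac (embed k S).
Proof.
have k0 : 0 < k by apply: leq_trans hk.
have [s [cs ms ->]] := SYT_chain hS.
have ct := chain_evacuate cs.
have mt : evacuate s =i diagram (staircase k).
  by move=> b; rewrite (perm_mem (perm_evacuate s)).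
have cg := glue_staircases_chain cs ct ms mt; have fg := glue_staircases_fills ms mt.
rewrite evac_fill // !embed_fill // evacuateK evac_fill //.
rewrite (evacuate_rectangle k0 cg fg) rotate_chain_cat rotate_chainK //.
move=> b; rewrite mt -topredE /=; case: b => i j; rewrite mem_staircase /in_rectangle /=.
lia.
Qed.
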